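(* Let $\mathbb{F}$ be an algebraically closed field of prime characteristic $p$ and let $G$ be a finite group. Let $P{\uparrow}Q_\phi$ be a generalized piece of $\mathbb{F}G$. Write $\overline{N}_P(Q)=N_P(Q)/Q$, write $N_P(Q_\phi)$ for the stabilizer of $Q_\phi$ in $P$, and write $\overline{N}_P(Q_\phi)=N_P(Q_\phi)/Q$. Let $S$ be a group with $\overline{N}_P(Q_\phi)\le S\le\overline{N}_P(Q)$. Then $P{\uparrow}Q_\phi$ is substantive if and only if the simple $\mathbb{F}(C_G(Q)\rtimes S)$-module $V(\phi_{\rtimes S})$ restricts to an $\mathbb{F}S$-module with a nonzero free direct summand.
   Context: Modules are finitely generated left modules. For a finite group $L$, $\mathrm{Irr}(\mathbb{F}L)$ is the set of irreducible Brauer characters of $\mathbb{F}L$; for $\xi\in\mathrm{Irr}(\mathbb{F}L)$, $V(\xi)$ is a simple $\mathbb{F}L$-module with Brauer character $\xi$ and $E(\xi)$ is its projective cover. A piece of $\mathbb{F}G$ is a pair $Q_\phi$ with $Q$ a $p$-subgroup of $G$ and $\phi\in\mathrm{Irr}(\mathbb{F}C_G(Q))$; $G$ acts on pieces by ${}^g(Q_\phi)=({}^gQ)_{{}^g\phi}$. A generalized piece $P{\uparrow}Q_\phi$ of $\mathbb{F}G$ is the equivalence class of a pair $(P,Q_\phi)$, where $P$ is a $p$-subgroup of $G$ and $Q_\phi$ is a piece of $\mathbb{F}G$ with $Q\le P$; pairs $(P,Q_\phi)$ and $(P',Q'_{\phi'})$ are equivalent if $P=P'$ and $Q_\phi,Q'_{\phi'}$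 are $P$-conjugate. A choice of $Q_\phi$ is fixed. If a finite $p$-group $S$ acts by automorphisms on a finite group $K$ and $\eta\in\mathrm{Irr}(\mathbb{F}K)$, then $\eta_{\rtimes S}$ denotes the unique irreducible Brauer character of $\mathbb{F}(K\rtimes S)$ such that $E(\eta_{\rtimes S})\cong\mathrm{Ind}_K^{K\rtimes S}(E(\eta))$ (equivalently, the restriction of $V(\eta_{\rtimes S})$ to $K$ is a direct sum of mutually non-isomorphic $S$-conjugates of $V(\eta)$). The group $\overline{N}_P(Q)$ and its subgroups act on $C_G(Q)$ by conjugation. Put $\overline{P}=\overline{N}_P(Q)$. The generalized piece $P{\uparrow}Q_\phi$ is substantive if the simple $\mathbb{F}(C_G(Q)\rtimes\overline{P})$-module $V(\phi_{\rtimes\overline{P}})$ restricts to an $\mathbb{F}\overline{P}$-module with a nonzero free direct summand; this is independent of the choice of $Q_\phi$. *)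

(* Defs.v *)
From HB Require Import structures.
From mathcomp Require Import all_boot all_order all_algebra.
From mathcomp Require Import all_fingroup all_solvable all_field all_character.

Set Implicit Arguments.
Unset Strict Implicit.
Unset Printing Implicit Defensive.

Import GroupScope GRing.Theory.
Local Open Scope ring_scope.

(* A module is a matrix representation acting on row vectors, so submodules   *)
(* are row spaces. This is a right action; nothing below depends on the side, *)
(* right modules over a group being left modules over the opposite group.     *)

Section Modules.

Variables (F : fieldType) (gT : finGroupType) (G : {group gT}).

Definition mx_intertwines m n (rU : mx_representation F G m)
    (rV : mx_representation F G n) (f : 'M[F]_(m, n)) : Prop :=
  {in G, forall x, rU x *m f = f *m rV x}.

Definition mx_projective n (rE : mx_representation F G n) : Prop :=
  forall (a b : nat) (rA : mx_representation F G a)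
         (rB : mx_representation F G b) (f : 'M_(a, b)) (h : 'M_(n, b)),
    mx_intertwines rA rB f -> row_full f -> mx_intertwines rE rB h ->
  exists2 k : 'M_(n, a), mx_intertwines rE rA k & k *m f = h.

(* A projective module with an essential epimorphism f onto V: no proper      *)
(* submodule U of E satisfies U + ker f = E.                                  *)
Definition projective_cover n m (rE : mx_representation F G n)
    (rV : mx_representation F G m) : Prop :=
  mx_projective rE /\
  exists f : 'M_(n, m),
    [/\ mx_intertwines rE rV f, row_full f
      & forall U : 'M_n, mxmodule rE U ->
          (1%:M <= U + kermx f)%MS -> (1%:M <= U)%MS].

Definition has_free_summand n (rV : mx_representation F G n) : Prop :=
  exists (k : nat) (W : representation F G),
    (0 < k)%N /\
    mx_rsim rV (dadd_grepr (muln_grepr (Representation (regular_repr F G)) k) W).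

End Modules.

(* rV is isomorphic to the module induced from rU along the embedding j:      *)
(* V has a K-submodule isomorphic to U (the image of f) whose translates by   *)
(* representatives of the cosets of j(K) in L give a direct decomposition.    *)
Definition induced_along (F : fieldType) (gT hT : finGroupType)
    (K : {group gT}) (L : {group hT}) (j : {morphism K >-> hT}) m n
    (rU : mx_representation F K m) (rV : mx_representation F L n) : Prop :=
  exists f : 'M[F]_(m, n),
    let T := (\sum_(C in rcosets (j @* K) L) <<f *m rV (repr C)>>)%MS in
    [/\ row_free f, {in K, forall x, rU x *m f = f *m rV (j x)},
        mxdirect T & (1%:M <= T)%MS].

Section BrauerCharacters.

Variable F : closedFieldType.

(* The fixed embedding of the roots of unity of F into those of algC used to  *)
(* form Brauer characters.                                                    *)
Definition brauer_lift (theta : F -> algC) : Prop :=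
  let mu (x : F) := exists2 n, (0 < n)%N & n.-unity_root x in
  [/\ theta 1 = 1,
      forall x y, mu x -> mu y -> theta (x * y) = theta x * theta y
    & forall x y, mu x -> mu y -> theta x = theta y -> x = y].

(* Roots of the characteristic polynomial, with multiplicity. *)
Definition eigenvalues n (A : 'M[F]_n) : seq F :=
  sval (closed_field_poly_normal (char_poly A)).

Variables (p : nat) (theta : F -> algC).

(* Brauer characters are defined on the p-regular elements of L; they are     *)
(* extended by 0, so that equality of functions is equality of characters.    *)
Definition brauer_char (gT : finGroupType) (L : {group gT}) n
    (rV : mx_representation F L n) : {ffun gT -> algC} :=
  [ffun x => if (x \in L) && p^'.-elt x
             then \sum_(z <- eigenvalues (rV x)) theta z else 0].

(* rV is V(xi). *)
Definition simple_affording (gT : finGroupType) (L : {group gT})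
    (xi : {ffun gT -> algC}) n (rV : mx_representation F L n) : Prop :=
  mx_irreducible rV /\ brauer_char rV = xi.

(* xi \in Irr(F L). *)
Definition irr_brauer (gT : finGroupType) (L : {group gT})
    (xi : {ffun gT -> algC}) : Prop :=
  exists (n : nat) (rV : mx_representation F L n), simple_affording xi rV.

(* rE is E(xi). *)
Definition cover_affording (gT : finGroupType) (L : {group gT})
    (xi : {ffun gT -> algC}) n (rE : mx_representation F L n) : Prop :=
  exists (m : nat) (rV : mx_representation F L m),
    simple_affording xi rV /\ projective_cover rE rV.

End BrauerCharacters.

Section SemidirectProducts.

Variables (aT rT : finGroupType) (S : {group aT}) (K : {group rT}).
Variable to : groupAction S K.

Definition sdprod_group : {group sdprod_by to} := [set: sdprod_by to]%G.

(* xi is the character eta_{\rtimes S}. *)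
Definition sdprod_brauer (F : closedFieldType) (p : nat) (theta : F -> algC)
    (eta : {ffun rT -> algC}) (xi : {ffun sdprod_by to -> algC}) : Prop :=
  exists (m n : nat) (rE : mx_representation F K m)
         (rE' : mx_representation F sdprod_group n),
    [/\ cover_affording p theta eta rE, cover_affording p theta xi rE'
      & induced_along (sdpair1 to) rE rE'].

Variables (F : fieldType) (n : nat) (rV : mx_representation F sdprod_group n).

Lemma sdprod_res_mx_repr : mx_repr S (fun s => rV (sdpair2 to s)).
Proof.
split=> [|s t Ss St]; first by rewrite morph1 repr_mx1.
by rewrite morphM // repr_mxM ?inE.
Qed.

Definition sdprod_res : mx_representation F S n :=
  MxRepresentation sdprod_res_mx_repr.

End SemidirectProducts.

Section Pieces.

Variables (gT : finGroupType) (G P Q : {group gT}).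

Lemma conj_acts_on_cent (S : {group coset_of Q}) :
    P \subset G -> S \subset ('N_P(Q) / Q)%g ->
  {acts S, on group 'C_G(Q) | 'J %% Q}.
Proof.
move=> sPG sSN; split; last by rewrite /= gacentJ subsetIr.
apply/subsetP=> _ /(subsetP sSN)/morphimP[a Na /setIP[Pa _] ->].
rewrite 2!inE mem_quotient ?inE //=; apply/subsetP=> x CQx; rewrite inE.
have [Gx Cx] := setIP CQx.
rewrite modactE //; first last.
- by apply/afixP=> z /setIP[_ Qz]; rewrite /= conjgE (centP Cx z Qz) mulKg.
rewrite /= in_setI groupJ ?(subsetP sPG a Pa) //=.
by have /normP <- := subsetP (norms_cent (subxx 'N(Q))) a Na; rewrite memJ_conjg.
Qed.

(* Conjugation by elements of S <= N_P(Q) / Q on C_G(Q). *)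
Definition conj_gact (S : {group coset_of Q}) (sPG : P \subset G)
    (sSN : S \subset ('N_P(Q) / Q)%g) : groupAction S 'C_G(Q) :=
  actby_groupAction (conj_acts_on_cent sPG sSN).

End Pieces.

(* ${}^g(Q_\phi)$; in MathComp ${}^gQ$ is Q :^ g^-1, and the value of         *)
(* ${}^g\phi$ at y is phi (g^-1 * y * g).                                     *)
Definition conj_piece (gT : finGroupType) (g : gT)
    (X : {set gT} * {ffun gT -> algC}) : {set gT} * {ffun gT -> algC} :=
  ((X.1 :^ g^-1)%g, [ffun y => X.2 (y ^ g)%g]).

(* A generalized piece of F G, with its chosen representative (P, Q_phi). *)
Record generalized_piece (F : closedFieldType) (p : nat) (theta : F -> algC)
    (gT : finGroupType) (G : {group gT}) := GeneralizedPiece {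
  gp_P : {group gT};
  gp_Q : {group gT};
  gp_phi : {ffun gT -> algC};
  gp_P_sub : gp_P \subset G;
  gp_P_pgroup : p.-group gp_P;
  gp_Q_sub : gp_Q \subset gp_P;
  gp_phi_irr : irr_brauer p theta 'C_G(gp_Q) gp_phi
}.

Section GeneralizedPieces.

Variables (F : closedFieldType) (p : nat) (theta : F -> algC).
Variables (gT : finGroupType) (G : {group gT}).
Variable X : generalized_piece p theta G.

Definition gp_stab : {set gT} :=
  [set g in gp_P X | conj_piece g (gval (gp_Q X), gp_phi X)
                     == (gval (gp_Q X), gp_phi X)].

Definition gp_act (S : {group coset_of (gp_Q X)})
    (sSN : S \subset ('N_(gp_P X)(gp_Q X) / gp_Q X)%g) :
    groupAction S 'C_G(gp_Q X) :=
  conj_gact (gp_P_sub X) sSN.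

Definition gp_Nbar : {group coset_of (gp_Q X)} :=
  ('N_(gp_P X)(gp_Q X) / gp_Q X)%G.

Definition substantive : Prop :=
  let to := gp_act (subxx gp_Nbar) in
  exists (xi : {ffun sdprod_by to -> algC}) (n : nat)
         (V : mx_representation F (sdprod_group to) n),
    [/\ sdprod_brauer p theta (gp_phi X) xi, simple_affording p theta xi V
      & has_free_summand (sdprod_res V)].

End GeneralizedPieces.

(* Main.v *)
(* Over the algebraically closed field F, Brauer characters determine simple  *)
(* modules: on a p-regular element the power sums of the lifted eigenvalues    *)
(* give back the eigenvalues, Frobenius extends the equality of traces to all  *)
(* elements, and simple modules with equal traces are isomorphic by density.   *)
(*   For a p-group S in characteristic p, a module has a free summand iff the  *)
(* norm element (the sum of S) acts on it as a nonzero operator. Moreover a    *)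
(* p-group acting on a space of C_G(Q)-homomorphisms has a nonzero fixed       *)
(* point, so V = V(phi_{><| S}) embeds in the restriction of                   *)
(* V' = V(phi_{><| Nbar}). Since S contains the stabilizer of phi, the         *)
(* translates of V by coset representatives of S have no common constituent    *)
(* over C_G(Q); the norm of Nbar is the norm of S followed by the sum of these *)
(* representatives, hence the two norms vanish simultaneously.                 *)
(*   The existence of phi_{><| Nbar} comes from the fact that the module       *)
(* induced from E(phi) has a unique maximal submodule, because phi occurs with *)
(* multiplicity one in any simple module lying over it.                        *)

Require Import Defs.
From HB Require Import structures.
From mathcomp Require Import all_boot all_order all_algebra.
From mathcomp Require Import all_fingroup all_solvable all_field all_character.
From Stdlib Require Import Classical.

Set Implicit Arguments.
Unset Strict Implicit.
Unset Printing Implicit Defensive.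

Import GroupScope GRing.Theory.
Local Open Scope ring_scope.

(** * Intertwining operators *)

(** Let K be C_G(Q), N the p-group [gp_Nbar X] and U = V(phi); let V and V' be simple modules over K
    x| S and K x| N affording the characters attached to phi. For a p-group in characteristic p, a
    free summand exists exactly when the norm element acts as a nonzero operator
    ([free_summand_norm], [norm_free_summand]), so the claim is that the norm of S on V and the norm
    of N on V' vanish together.

    Each module is spanned by the translates of a copy of U, so its norm need only be tested on such
    a copy ([norm_mx_translates]). A nonzero S-equivariant K-map from V to V' exists
    ([pair_common_constituent]) and is injective, so one copy of U serves for both. Since S contains
    the stabilizer of U, translates of U by S and by N \ S share no K-constituent; hence the part of
    the norm of N coming from S cannot be cancelled by the rest ([norm_mx_pair_iff]).

    Brauer characters enter through two facts: they determine simple modules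
    ([simple_affording_rsim]), and V and V' contain U over K ([sdprod_brauer_constituent]). The
    implication towards [substantive] also needs V' to exist: by [induced_repr_cover], resting on
    [pair_multiplicity_one], inducing E(phi) gives the projective cover of a simple module. *)

Section Intertwiners.

Variables (F : fieldType) (gT : finGroupType) (G : {group gT}).

Lemma intertwines_comp m n k (rU : mx_representation F G m)
    (rV : mx_representation F G n) (rW : mx_representation F G k) f g :
  mx_intertwines rU rV f -> mx_intertwines rV rW g -> mx_intertwines rU rW (f *m g).
Proof. by move=> homf homg x Gx; rewrite mulmxA homf // -!mulmxA homg. Qed.

Variables (m n : nat).
Variables (rU : mx_representation F G m) (rV : mx_representation F G n).

Lemma intertwinesZ a f :
  mx_intertwines rU rV f -> mx_intertwines rU rV (a *: f).
Proof. by move=> homf x Gx; rewrite -scalemxAr -scalemxAl homf. Qed.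

Variable f : 'M[F]_(m, n).
Hypothesis homf : mx_intertwines rU rV f.

Lemma intertwines_ker_module : mxmodule rU (kermx f).
Proof.
apply/mxmoduleP=> x Gx; apply/sub_kermxP.
by rewrite -mulmxA homf // mulmxA mulmx_ker mul0mx.
Qed.

Lemma intertwines_im_module k (W : 'M_(k, m)) :
  mxmodule rU W -> mxmodule rV (W *m f).
Proof.
move/mxmoduleP=> modW; apply/mxmoduleP=> x Gx.
by rewrite -mulmxA -homf // mulmxA submxMr ?modW.
Qed.

Lemma irr_intertwines_free : mx_irreducible rU -> f != 0 -> row_free f.
Proof.
case/mx_irrP=> _ irrU nzf; rewrite -kermx_eq0; apply: contraNT nzf => nzk.
have := irrU _ intertwines_ker_module nzk.
by rewrite -sub1mx => /sub_kermxP; rewrite mul1mx => ->.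
Qed.

Lemma irr_intertwines_full : mx_irreducible rV -> f != 0 -> row_full f.
Proof.
case/mx_irrP=> _ irrV nzf; rewrite -sub1mx -(genmxE f) sub1mx; apply: irrV.
  by rewrite (eqmx_module _ (genmxE f)) -[f]mul1mx intertwines_im_module ?mxmodule1.
by rewrite (eqmx_eq0 (genmxE f)).
Qed.

Lemma irr_intertwines_rsim :
  mx_irreducible rU -> mx_irreducible rV -> f != 0 -> mx_rsim rU rV.
Proof.
move=> irrU irrV nzf; have freef := irr_intertwines_free irrU nzf.
exists f => //; apply/eqP; rewrite -(eqP freef).
exact: irr_intertwines_full irrV nzf.
Qed.

End Intertwiners.

Lemma rsim_intertwines (F : fieldType) (gT : finGroupType) (G : {group gT}) m n
    (rU : mx_representation F G m) (rV : mx_representation F G n) :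
  mx_rsim rU rV ->
  exists f, [/\ mx_intertwines rU rV f, row_free f & row_full f].
Proof. by case=> f eq_mn freef homf; exists f; split=> //; rewrite /row_full -{2}eq_mn. Qed.

(** Schur's lemma: cancelling the injective [f] in [g = B *m f] makes [B] an endomorphism of a
    simple module over an algebraically closed field. *)
Lemma intertwines_scalar (F : closedFieldType) (gT : finGroupType) (G : {group gT})
    m n (rU : mx_representation F G m) (rV : mx_representation F G n) f g :
    mx_irreducible rU -> mx_intertwines rU rV f -> mx_intertwines rU rV g ->
    row_free f -> (g <= f)%MS ->
  exists c, g = c *: f.
Proof.
move=> irrU homf homg freef /submxP[B Dg].
have cUB: centgmx rU B.
  apply/centgmxP=> x Gx; apply: (row_free_inj freef).
  by rewrite /= -!mulmxA homf // !mulmxA -Dg -homg // Dg !mulmxA.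
have abs_irr: mx_absolutely_irreducible rU by apply: group_closure_closed_field.
have /is_scalar_mxP[c Dc] := mx_abs_irr_cent_scalar abs_irr cUB.
by exists c; rewrite Dg Dc mul_scalar_mx.
Qed.

Lemma in_factmod_intertwines (F : fieldType) (gT : finGroupType) (G : {group gT}) n
    (rM : mx_representation F G n) (U : 'M_n) (modU : mxmodule rM U) :
  mx_intertwines rM (factmod_repr modU) (in_factmod U 1%:M).
Proof.
by move=> x Gx; rewrite -[RHS](in_factmodJ modU) // mul1mx [RHS]in_factmodE.
Qed.

Lemma in_factmod_mul_eq0 (F : fieldType) n k (U : 'M[F]_n) (g : 'M_(\rank (cokermx U), k)) :
  (in_factmod U 1%:M *m g == 0) = (g == 0).
Proof.
apply/eqP/eqP=> [g0 | ->]; last by rewrite mulmx0.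
by rewrite -[g]mul1mx -[1%:M](@val_factmodK _ _ U) in_factmodE -mulmxA g0 mulmx0.
Qed.

(** Induction on the dimension: a reducible module is replaced by its factor by a proper nonzero
    submodule. *)
Lemma irr_quotient_exists (F : fieldType) (gT : finGroupType) (G : {group gT}) n
    (rM : mx_representation F G n) :
  (0 < n)%N -> exists k (rV : mx_representation F G k) g,
    [/\ mx_irreducible rV, mx_intertwines rM rV g & g != 0].
Proof.
have [N] := ubnP n; elim: N => // N IHN in n rM *; rewrite ltnS => le_nN n_gt0.
have [irrM | redM] := classic (mx_irreducible rM).
  exists n, rM, 1%:M; split=> // [x Gx|]; first by rewrite mulmx1 mul1mx.
  by rewrite -mxrank_eq0 mxrank1 -lt0n.
have [U [modU nzU ltU]] : exists U : 'M_n, [/\ mxmodule rM U, U != 0 & (\rank U < n)%N].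
  apply: NNPP => noU; case: redM; apply/mx_irrP; split=> // U modU nzU.
  apply: contra_notT noU => nfullU; exists U; split=> //.
  by rewrite ltn_neqAle nfullU rank_leq_row.
have [||k [rV [g [irrV homg nzg]]]] := IHN _ (factmod_repr modU).
- rewrite mxrank_coker (leq_trans _ le_nN) // ltn_subrL n_gt0 andbT.
  by rewrite lt0n mxrank_eq0.
- by rewrite mxrank_coker subn_gt0.
exists k, rV, (in_factmod U 1%:M *m g); split=> //.
  exact: intertwines_comp (in_factmod_intertwines modU) homg.
by rewrite in_factmod_mul_eq0.
Qed.

(** * Brauer characters determine simple modules *)

Section Eigenvalues.

Variable F : closedFieldType.

Lemma horner_ext_eq (q r : {poly F}) : (forall w, q.[w] = r.[w]) -> q = r.
Proof.
move=> eq_qr; apply/eqP; rewrite -subr_eq0; set d := q - r.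
have d0 w : d.[w] = 0 by rewrite !hornerE eq_qr subrr.
(* For nonzero [d], the polynomial [d * 'X + 1] is not constant, yet it takes the value 1 everywhere
   and so has no root. *)
apply: contraT => nz_d; have /closed_rootP[w]: size (d * 'X + 1%:P) != 1%N.
  by rewrite -cons_poly_def size_cons_poly nil_poly (negPf nz_d) /= eqSS size_poly_eq0.
by rewrite /root hornerMXaddC d0 mul0r add0r oner_eq0.
Qed.

Lemma horner_char_poly n (A : 'M[F]_n) w : (char_poly A).[w] = \det (w%:M - A).
Proof.
rewrite -[LHS]/(horner_eval w _) -det_map_mx; congr (\det _).
apply/matrixP=> i j; rewrite !mxE rmorphB rmorphMn /=.
by rewrite /horner_eval hornerX hornerC.
Qed.

Lemma eigenvaluesP n (A : 'M[F]_n) :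
  char_poly A = \prod_(z <- eigenvalues A) ('X - z%:P).
Proof.
rewrite /eigenvalues; case: closed_field_poly_normal => s /= ->.
by rewrite (monicP (char_poly_monic A)) scale1r.
Qed.

Lemma size_eigenvalues n (A : 'M[F]_n) : size (eigenvalues A) = n.
Proof. by have := size_char_poly A; rewrite eigenvaluesP size_prod_XsubC => -[]. Qed.

Lemma eigenvalues_perm n (A : 'M[F]_n) s :
  char_poly A = \prod_(z <- s) ('X - z%:P) -> perm_eq (eigenvalues A) s.
Proof. by rewrite eigenvaluesP => /prod_XsubC_eq. Qed.

(** Splitting [q] into linear factors leaves determinants of [A - w], which up to sign are values of
    the characteristic polynomial. Taking [q] to be [w%:P - 'X^k] gives the eigenvalues of
    [A ^+ k]. *)
Lemma det_horner_mx n (A : 'M[F]_n.+1) q :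
  \det (horner_mx A q) = \prod_(z <- eigenvalues A) q.[z].
Proof.
have [s Dq] := closed_field_poly_normal q.
have Eq z : q.[z] = lead_coef q * \prod_(w <- s) (z - w).
  rewrite {1}Dq hornerZ horner_prod; congr (_ * _).
  by apply: eq_bigr => w _; rewrite !hornerE.
rewrite {1}Dq linearZ /= detZ (eq_bigr _ (fun z _ => Eq z)) big_split /=.
rewrite big_const_seq count_predT size_eigenvalues iter_mulr_1; congr (_ * _).
rewrite rmorph_prod /= exchange_big /=.
rewrite (big_morph (fun M : 'M[F]_n.+1 => \det M) (fun M N => det_mulmx M N) (det1 F _)).
apply: eq_bigr => w _; rewrite rmorphB /= horner_mx_X horner_mx_C.
rewrite -opprB -scaleN1r detZ -horner_char_poly eigenvaluesP horner_prod.
have ->: (-1) ^+ n.+1 = \prod_(z <- eigenvalues A) -1 :> F.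
  by rewrite big_const_seq count_predT size_eigenvalues iter_mulr_1.
rewrite -big_split /=.
by apply: eq_bigr => z _; rewrite !hornerE mulN1r opprB.
Qed.

Lemma eigenvalues_exp n (A : 'M[F]_n.+1) k :
  perm_eq (eigenvalues (A ^+ k)) [seq z ^+ k | z <- eigenvalues A].
Proof.
apply: eigenvalues_perm; apply: horner_ext_eq => w.
rewrite horner_char_poly horner_prod big_map.
have ->: w%:M - A ^+ k = horner_mx A (w%:P - 'X^k).
  by rewrite rmorphB rmorphXn /= horner_mx_C horner_mx_X.
by rewrite det_horner_mx; apply: eq_bigr => z _; rewrite !hornerE.
Qed.

Lemma trace_eigenvalues n (A : 'M[F]_n.+1) : \tr A = \sum_(z <- eigenvalues A) z.
Proof.
apply: oppr_inj; rewrite -char_poly_trace // eigenvaluesP.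
by rewrite -[in X in _`_X](size_eigenvalues A) coefPn_prod_XsubC ?size_eigenvalues.
Qed.

Lemma eigenvalues_unity n (A : 'M[F]_n.+1) k z :
  A ^+ k = 1 -> z \in eigenvalues A -> z ^+ k = 1.
Proof.
move=> Ak1 ez; have: z ^+ k \in eigenvalues (A ^+ k).
  by rewrite (perm_mem (eigenvalues_exp A k)); apply: map_f.
rewrite -root_prod_XsubC -eigenvaluesP /root Ak1 horner_char_poly.
rewrite -[1 in X in X == _]/(1%:M) -raddfB /= det_scalar expf_eq0 /= subr_eq0.
by move/eqP.
Qed.

Lemma trace_pchar_exp p a n (A : 'M[F]_n.+1) : p \in [pchar F] ->
  \tr (A ^+ (p ^ a)) = \tr A ^+ (p ^ a).
Proof.
move=> charFp; rewrite !trace_eigenvalues (perm_big _ (eigenvalues_exp _ _)) big_map.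
elim: a => [|a IHa]; first by rewrite expr1.
rewrite expnSr exprM -IHa -(pFrobenius_autE charFp) rmorph_sum /=.
by apply: eq_bigr => z _; rewrite pFrobenius_autE -exprM.
Qed.

End Eigenvalues.

(** Equal power sums give equal sums of every polynomial; one that vanishes at all entries except
    [b] isolates the multiplicity of [b], which characteristic 0 lets one recover. *)
Lemma power_sums_perm (C : numFieldType) (s t : seq C) :
  (forall k, \sum_(x <- s) x ^+ k = \sum_(x <- t) x ^+ k) -> perm_eq s t.
Proof.
move=> eq_st; have eq_pol (q : {poly C}) : \sum_(x <- s) q.[x] = \sum_(x <- t) q.[x].
  have E r : \sum_(x <- r) q.[x] = \sum_(i < size q) q`_i * \sum_(x <- r) x ^+ i.
    rewrite (eq_bigr _ (fun x _ => horner_coef q x)) exchange_big /=.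
    by apply: eq_bigr => i _; rewrite mulr_sumr.
  by rewrite !E; apply: eq_bigr => i _; rewrite eq_st.
apply/allP=> b _ /=; set r := [seq c <- undup (s ++ t) | c != b].
pose q := \prod_(c <- r) ('X - c%:P).
have nz_qb : q.[b] != 0.
  by rewrite -[_ == _]/(root q b) root_prod_XsubC mem_filter eqxx.
have q_count u : {subset u <= s ++ t} ->
  \sum_(x <- u) q.[x] = (count_mem b u)%:R * q.[b].
  move=> sub_u; rewrite (bigID (pred1 b)) /= addrC big1_seq ?add0r => [|x /andP[nbx ux]].
    rewrite (eq_bigr (fun _ => q.[b])) => [|x /eqP-> //].
    by rewrite big_const_seq iter_addr_0 mulr_natl.
  by apply/eqP; rewrite -[_ == _]/(root q x) root_prod_XsubC mem_filter nbx mem_undup sub_u.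
have := eq_pol q; rewrite !q_count; first last.
- by move=> x; rewrite mem_cat => ->.
- by move=> x; rewrite mem_cat => ->; rewrite orbT.
by move/(mulIf nz_qb)/eqP; rewrite Num.Theory.eqr_nat.
Qed.

Section BrauerUniqueness.

Variables (F : closedFieldType) (p : nat) (theta : F -> algC).
Hypotheses (charFp : p \in [pchar F]) (theta_lift : brauer_lift theta).

Lemma brauer_lift_exp N (z : F) k : (0 < N)%N -> z ^+ N = 1 -> theta (z ^+ k) = theta z ^+ k.
Proof.
move=> N_gt0 zN1; have [th1 thM _] := theta_lift.
have muX j : exists2 n, (0 < n)%N & n.-unity_root (z ^+ j).
  by exists N => //; apply/unity_rootP; rewrite exprAC zN1 expr1n.
elim: k => [|k IHk]; first by rewrite !expr0.
by rewrite !exprS thM ?IHk //; apply: muX 1.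
Qed.

Variables (gT : finGroupType) (L : {group gT}).

Lemma brauer_char_trace m n (rU : mx_representation F L m.+1)
    (rV : mx_representation F L n.+1) :
  brauer_char p theta rU = brauer_char p theta rV ->
  {in L, forall x, \tr (rU x) = \tr (rV x)}.
Proof.
move=> eqUV; have p_pr := pcharf_prime charFp.
have trace_p' x : x \in L -> p^'.-elt x -> \tr (rU x) = \tr (rV x).
  move=> Lx p'x; rewrite !trace_eigenvalues; apply: perm_big.
  have repr_unity k (r : mx_representation F L k.+1) z :
    z \in eigenvalues (r x) -> z ^+ #[x]%g = 1.
    by apply: eigenvalues_unity; rewrite -repr_mxX // expg_order repr_mx1.
  have [_ _ th_inj] := theta_lift.
  have th_injx y z : y \in eigenvalues (rU x) ++ eigenvalues (rV x) ->
    z \in eigenvalues (rU x) ++ eigenvalues (rV x) -> theta y = theta z -> y = z.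
    rewrite !mem_cat => ey ez; apply: th_inj; exists #[x]%g => //.
      by apply/unity_rootP; case/orP: ey => /repr_unity.
    by apply/unity_rootP; case/orP: ez => /repr_unity.
  have eq_th: perm_eq (map theta (eigenvalues (rU x))) (map theta (eigenvalues (rV x))).
    apply: power_sums_perm => k; rewrite !big_map.
    have sumX d (r : mx_representation F L d.+1) :
      \sum_(z <- eigenvalues (r x)) theta z ^+ k = brauer_char p theta r (x ^+ k)%g.
      have Lxk : (x ^+ k)%g \in L := groupX k Lx.
      have p'xk : p^'.-elt (x ^+ k)%g := p_eltX k p'x.
      rewrite ffunE Lxk p'xk (repr_mxX r k Lx).
      rewrite (perm_big _ (eigenvalues_exp (r x) k)) big_map.
      apply: eq_big_seq => z /repr_unity z1.
      by rewrite (brauer_lift_exp _ (order_gt0 x)).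
    by rewrite !sumX eqUV.
  apply/allP=> y ey /=; move/seq.permP: eq_th => /(_ (pred1 (theta y))).
  rewrite !count_map => eq_ct; apply/eqP.
  have ct s : {subset s <= eigenvalues (rU x) ++ eigenvalues (rV x)} ->
    count_mem y s = count (preim theta (pred1 (theta y))) s.
    move=> ss; apply: eq_in_count => z /ss sz /=.
    by apply/eqP/eqP=> [-> | /th_injx->].
  by rewrite !ct // => z zs; rewrite mem_cat zs ?orbT.
(* With [q] the [p]-part of the order, [x ^+ q] is [p]-regular and its trace is the [q]-th power of
   that of [x]; Frobenius is injective. *)
move=> x Lx; set q := (#[x] `_ p)%N.
have [a Dq]: exists a, q = (p ^ a)%N by rewrite /q p_part; eexists.
have p'xq : p^'.-elt (x ^+ q)%g.
  rewrite /p_elt orderXdiv ?dvdn_part // -{1}(partnC p (order_gt0 x)) mulKn ?part_gt0 //.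
  exact: part_pnat.
have := trace_p' _ (groupX q Lx) p'xq; rewrite !repr_mxX // Dq !(trace_pchar_exp _ _ charFp).
elim: a {Dq p'xq} => [|a IHa]; first by rewrite !expr1.
rewrite expnSr !exprM -!(pFrobenius_autE charFp) => /fmorph_inj; exact: IHa.
Qed.

(** By density the group ring maps onto the full matrix algebra, where the trace form is
    nondegenerate. Equal traces therefore force equal annihilators, and a cyclic generator of U can
    be sent to a suitable vector of V. *)
Lemma trace_irr_rsim m n (rU : mx_representation F L m.+1)
    (rV : mx_representation F L n.+1) :
    mx_irreducible rU -> mx_irreducible rV ->
  {in L, forall x, \tr (rU x) = \tr (rV x)} -> mx_rsim rU rV.
Proof.
move=> irrU irrV eq_tr.
have full d (r : mx_representation F L d.+1) : mx_irreducible r ->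
    forall B, exists b, gring_mx r b = B.
  move=> /(group_closure_closed_field (gT := gT)) /andP[_ /row_fullP[E' E'E]] B.
  by exists (mxvec B *m E'); rewrite /gring_mx /= -mulmxA E'E mulmx1 mxvecK.
have eq_trg b : \tr (gring_mx rU b) = \tr (gring_mx rV b).
  rewrite /gring_mx /= !mulmx_sum_row !linear_sum; apply: eq_bigr => i _.
  by rewrite !linearZ /= !rowK !mxvecK eq_tr ?enum_valP.
have ann d e (r : mx_representation F L d.+1) (s : mx_representation F L e.+1) a :
    mx_irreducible r -> (forall b, \tr (gring_mx r b) = \tr (gring_mx s b)) ->
  gring_mx s a = 0 -> gring_mx r a = 0.
  move=> irr eq_rs sa0; apply/matrixP=> i j; rewrite [RHS]mxE.
  have [b Db] := full _ _ irr (delta_mx j i).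
  have: \tr (gring_mx r a *m delta_mx j i) = 0.
    by rewrite -Db -gring_mxA eq_rs gring_mxA sa0 mul0mx mxtrace0.
  rewrite -[delta_mx j i](mul_delta_mx (0 : 'I_1)) mulmxA mxtrace_mulC.
  by rewrite -rowE -colE /= /mxtrace big_ord1 !mxE.
(* [a] acts on U as the projection onto the first basis vector; any nonzero [u] in its image on V is
   then killed by whatever kills that basis vector. *)
have [a Da] := full _ _ irrU (delta_mx 0 0).
have nz_va: gring_mx rV a != 0.
  apply/eqP=> va0; move/matrixP/(_ 0 0): Da; rewrite (ann _ _ _ _ _ irrU eq_trg va0).
  by rewrite !mxE; move/eqP; rewrite eq_sym oner_eq0.
set u := nz_row (gring_mx rV a).
have vanish b : row 0 (gring_mx rU b) = 0 -> u *m gring_mx rV b = 0.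
  move=> b0; have: gring_mx rU a *m gring_mx rU b = 0.
    by rewrite Da -(mul_delta_mx (0 : 'I_1)) -mulmxA -rowE b0 mulmx0.
  rewrite -gring_mxA => /(ann _ _ rV rU _ irrV (fun b => esym (eq_trg b))).
  rewrite gring_mxA => vab; have /submxP[w ->]: (u <= gring_mx rV a)%MS by apply: nz_row_sub.
  by rewrite -mulmxA vab mulmx0.
have /fin_all_exists[c Dc] i := full _ _ irrU (delta_mx 0 i).
(* [c i] carries the first basis vector to the [i]-th, so [f] sends the first basis vector times [b]
   to [u] times [b]. *)
pose f : 'M_(m.+1, n.+1) := \matrix_i (u *m gring_mx rV (c i)).
have fE b : row 0 (gring_mx rU b) *m f = u *m gring_mx rV b.
  apply/eqP; rewrite -subr_eq0 mulmx_sum_row; set w := row 0 _.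
  rewrite (eq_bigr (fun i => u *m gring_mx rV (w 0 i *: c i))) => [|i _]; last first.
    by rewrite rowK linearZ /= -scalemxAr.
  rewrite -mulmx_sumr -linear_sum /= -mulmxBr -linearB; apply/eqP/vanish.
  rewrite !linearB !linear_sum /= -/w; apply/eqP; rewrite subr_eq0; apply/eqP.
  rewrite [RHS]row_sum_delta; apply: eq_bigr => i _.
  by rewrite !linearZ /= Dc rowE mul_delta_mx.
have homf x : x \in L -> rU x *m f = f *m rV x.
  move=> Lx; apply/row_matrixP=> i; rewrite !row_mul rowK -mulmxA -gring_mxJ // -fE.
  by rewrite gring_mxJ // Dc row_mul [row 0 (delta_mx _ _)]rowE mul_delta_mx -rowE.
apply: (irr_intertwines_rsim homf) => //; apply/eqP=> f0.
have /eqP[]: u != 0 by rewrite nz_row_eq0.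
have := fE (gring_row 1%:M); rewrite -!gring_opE !gring_op1 f0 mulmx0 mulmx1.
by move=> <-.
Qed.

End BrauerUniqueness.

Lemma eigenvalues_similar (F : closedFieldType) n (A B P : 'M[F]_n) :
  P \in unitmx -> A *m P = P *m B -> eigenvalues A = eigenvalues B.
Proof.
move=> uP eqAP; rewrite /eigenvalues; suffices -> : char_poly A = char_poly B by [].
apply: horner_ext_eq => w; rewrite !horner_char_poly.
have: (w%:M - A) *m P = P *m (w%:M - B).
  by rewrite mulmxBl mulmxBr eqAP scalar_mxC.
move/(congr1 determinant); rewrite !det_mulmx mulrC; apply: mulfI.
by rewrite -unitfE -unitmxE.
Qed.

Lemma simple_affording_rsim (F : closedFieldType) (p : nat) (theta : F -> algC)
    (gT : finGroupType) (L : {group gT}) xi m n (rU : mx_representation F L m)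
    (rV : mx_representation F L n) :
    p \in [pchar F] -> brauer_lift theta ->
  simple_affording p theta xi rU -> simple_affording p theta xi rV -> mx_rsim rU rV.
Proof.
move=> charFp theta_lift [irrU <-] [irrV eqVU].
have [m_gt0 _] := iffLR (mx_irrP rU) irrU; have [n_gt0 _] := iffLR (mx_irrP rV) irrV.
case: m m_gt0 rU irrU eqVU => // m _ rU irrU; case: n n_gt0 rV irrV => // n _ rV irrV eqVU.
apply: trace_irr_rsim => //.
exact: (brauer_char_trace charFp theta_lift (esym eqVU)).
Qed.

(** * Modular representations of p-groups *)

Section PGroups.

Variables (F : fieldType) (p : nat) (gT : finGroupType) (S : {group gT}).
Hypotheses (charFp : p \in [pchar F]) (pS : p.-group S).

(** Staying in the cyclic submodule of [u] presents the fixed vector as a combination of translates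
    of [u]. *)
Lemma pgroup_fixed_vector n (rW : mx_representation F S n) (u : 'rV_n) : u != 0 ->
  exists w : 'rV_n, [/\ w != 0, (w <= cyclic_mx rW u)%MS
                      & {in S, forall a, w *m rW a = w}].
Proof.
move=> nzu; have modU := cyclic_mx_module rW u; set U := cyclic_mx rW u in modU *.
have rU : (0 < \rank U)%N by rewrite lt0n mxrank_eq0 cyclic_mx_eq0.
have := rfix_pgroup_pchar charFp (submod_repr modU) rU pS (subxx _).
case/rowV0Pn=> v fixv nzv; exists (val_submod v); split.
- by rewrite val_submod_eq0.
- exact: val_submodP.
move=> a Sa; rewrite -(val_submodJ modU) //; congr val_submod.
by move/rfix_mxP: fixv => /(_ a Sa).
Qed.

(** S acts on linear maps by conjugation, with the S-homomorphisms as fixed points. The explicit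
    combination lets [g] inherit linear properties of [g0] that conjugation preserves, such as
    commuting with K. *)
Lemma pgroup_intertwiner m n (r1 : mx_representation F S m)
    (r2 : mx_representation F S n) g0 : g0 != 0 ->
  exists c : gT -> F,
    let g := \sum_(a in S) c a *: (r1 a^-1%g *m g0 *m r2 a) in
    g != 0 /\ mx_intertwines r1 r2 g.
Proof.
move=> nzg0; pose act a : 'M[F]_(m * n) := lin_mx (mulmx (r1 a^-1%g) \o mulmxr (r2 a)).
have actP : mx_repr S act.
  split=> [|a b Sa Sb]; apply/row_matrixP=> i; rewrite !rowE.
    by rewrite mul_rV_lin /= invg1 !repr_mx1 !mulmx1 mul1mx vec_mxK.
  rewrite mulmxA !mul_rV_lin /= mxvecK invMg !repr_mxM ?groupV //.
  by rewrite !mulmxA.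
pose rH := MxRepresentation actP.
have nzu : mxvec g0 != 0 by rewrite mxvec_eq0.
have [w [nzw /cyclic_mxP[A /envelop_mxP[c ->] Dw] fixw]] := pgroup_fixed_vector rH nzu.
exists c; set g := \sum_(a in S) _.
have Dg : mxvec g = w.
  rewrite Dw /g mulmx_sumr linear_sum; apply: eq_bigr => a _.
  by rewrite linearZ -scalemxAr /= mul_vec_lin /= mulmxA.
split=> [|a Sa]; first by rewrite -mxvec_eq0 Dg.
have := fixw a Sa; rewrite -Dg /= mul_vec_lin /= => /(can_inj mxvecK) {1}<-.
by rewrite !mulmxA -repr_mxM ?groupV // mulgV repr_mx1 mul1mx.
Qed.

End PGroups.

Lemma closed_field_root (F : closedFieldType) N (x : F) :
  (0 < N)%N -> exists y, y ^+ N = x.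
Proof.
move=> N_gt0; have /closed_rootP[y]: size ('X^N - x%:P) != 1%N.
  by rewrite size_XnsubC // eqSS -lt0n.
by rewrite /root !hornerE subr_eq0 => /eqP; exists y.
Qed.

(* Multiplying the cocycle identity over the third variable shows that the    *)
(* |T|-th power of the cocycle is a coboundary; as |T| is a power of the      *)
(* characteristic, |T|-th roots are unique and the cocycle is a coboundary.   *)
Lemma pgroup_projective_lift (F : closedFieldType) p (gT : finGroupType)
    (T : {group gT}) m (A : gT -> 'M[F]_m.+1) :
    p \in [pchar F] -> p.-group T -> {in T, forall t, A t \in unitmx} ->
    {in T &, forall s t, exists c, A s *m A t = c *: A (s * t)%g} ->
  exists2 b : gT -> F, {in T, forall t, b t != 0} & mx_repr T (fun t => b t *: A t).
Proof.
move=> charFp pT uA projA.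
have [c Dc]: exists c : gT -> gT -> F,
    {in T &, forall s t, A s *m A t = c s t *: A (s * t)%g}.
  have D0 s : exists cs : gT -> F, forall t, s \in T -> t \in T ->
      A s *m A t = cs t *: A (s * t)%g.
    have D1 t : exists cst, s \in T -> t \in T -> A s *m A t = cst *: A (s * t)%g.
      have [Ts|] := boolP (s \in T); last by exists 0.
      have [Tt|] := boolP (t \in T); last by exists 0.
      by have [cst] := projA s t Ts Tt; exists cst.
    by have [cs Dcs] := fin_all_exists D1; exists cs.
  by have [c Dc] := fin_all_exists D0; exists c => s t Ts Tt; apply: Dc.
have nz_scal t : t \in T -> A t != 0.
  by move/uA; apply: contraTneq => ->; rewrite unitmxE det0 unitr0.
have nzc : {in T &, forall s t, c s t != 0}.
  move=> s t Ts Tt; apply: contraTneq (uA s Ts) => c0.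
  have: A s *m A t \in unitmx by rewrite unitmx_mul !uA.
  by rewrite Dc // c0 scale0r unitmxE det0 unitr0.
have cocycle : {in T & &, forall s t u, c s t * c (s * t)%g u = c t u * c s (t * u)%g}.
  move=> s t u Ts Tt Tu.
  have: A s *m A t *m A u = A s *m (A t *m A u) by rewrite mulmxA.
  rewrite !Dc // -scalemxAl -scalemxAr !Dc ?groupM // !scalerA mulgA.
  move/eqP; rewrite -subr_eq0 -scalerBl scaler_eq0 subr_eq0 orbC.
  by rewrite (negPf (nz_scal _ _)) ?groupM // => /eqP.
pose gam s := \prod_(u in T) c s u.
have gamP : {in T &, forall s t, c s t ^+ #|T| * gam (s * t)%g = gam t * gam s}.
  move=> s t Ts Tt; rewrite -prodr_const -big_split /=.
  rewrite (eq_bigr (fun u => c t u * c s (t * u)%g)) => [|u Tu]; last exact: cocycle.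
  rewrite big_split /=; congr (_ * _).
  rewrite [RHS](reindex_inj (mulgI t)) /=.
  by apply: eq_bigl => u; rewrite groupMl.
have [b Db]: exists b : gT -> F, forall s, b s ^+ #|T| = gam s.
  have D0 s : exists y, y ^+ #|T| = gam s by apply: closed_field_root.
  by have [b Db] := fin_all_exists D0; exists b.
have rootI : injective (fun x : F => x ^+ #|T|).
  have [a ->] := p_natP pT; elim: a => [|a IHa] x y.
    by rewrite !expr1.
  rewrite expnSr !exprM -!(pFrobenius_autE charFp) => /fmorph_inj; exact: IHa.
have nzgam s : s \in T -> gam s != 0.
  by move=> Ts; apply/prodf_neq0=> u Tu; apply: nzc.
have nzb s : s \in T -> b s != 0.
  by move/nzgam; rewrite -Db expf_eq0 cardG_gt0.
have cb : {in T &, forall s t, c s t * b (s * t)%g = b t * b s}.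
  by move=> s t Ts Tt; apply: rootI; rewrite /= !exprMn !Db gamP.
have mulA : {in T &, forall s t,
    ((b (s * t)%g)^-1 *: A (s * t)%g) = ((b s)^-1 *: A s) *m ((b t)^-1 *: A t)}.
  move=> s t Ts Tt; rewrite -scalemxAl -scalemxAr Dc // !scalerA.
  congr (_ *: _); apply: (mulIf (nzb _ (groupM Ts Tt))).
  by rewrite mulVf ?nzb ?groupM // -!mulrA cb // mulKf ?nzb // mulVf ?nzb.
exists (fun t => (b t)^-1) => [t Tt|]; first by rewrite invr_eq0 nzb.
(* Multiplicativity at the identity makes [B] an invertible idempotent, hence 1. *)
split=> //; set B := _ *: _.
have uB : B \in unitmx by rewrite unitmxZ ?uA // unitfE invr_eq0 nzb.
have := mulA 1%g 1%g (group1 T) (group1 T); rewrite mulg1 -/B => /esym BB.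
by rewrite -(mulmxK uB B) BB mulmxV.
Qed.

(** * Free direct summands and the norm element *)

Section FreeSummands.

Variables (F : fieldType) (p : nat) (gT : finGroupType) (S : {group gT}).
Hypotheses (charFp : p \in [pchar F]) (pS : p.-group S).

Local Notation aS := (regular_repr F S).

Definition norm_mx n (rV : mx_representation F S n) := \sum_(s in S) rV s.

Lemma norm_mxMr n (rV : mx_representation F S n) a :
  a \in S -> norm_mx rV *m rV a = norm_mx rV.
Proof.
move=> Sa; rewrite /norm_mx mulmx_suml [RHS](reindex_inj (mulIg a)) /=.
by apply: eq_big => s; [rewrite groupMr | move=> Ss; rewrite repr_mxM].
Qed.

Lemma norm_regular_neq0 : norm_mx aS != 0.
Proof.
apply/eqP=> /(congr1 (@gring_proj F _ S 1%g)).
rewrite linear0 linear_sum (bigD1 1%g) //= gring_projE // eqxx big1 ?addr0.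
  by move/eqP; rewrite oner_eq0.
by move=> x /andP[Sx nx1]; rewrite gring_projE // eq_sym (negPf nx1).
Qed.

Lemma free_summand_norm n (rV : mx_representation F S n) :
  has_free_summand rV -> norm_mx rV != 0.
Proof.
case=> k [W [k_gt0 /mx_rsim_sym/rsim_intertwines[B [homB freeB fullB]]]].
case: k k_gt0 B homB freeB fullB => // k _; rewrite /muln_grepr big_ord_recl => B homB freeB fullB.
apply/eqP=> norm0; case/eqP: norm_regular_neq0.
set rD := dadd_grepr _ _ in B homB freeB fullB.
have normD0: norm_mx rD = 0.
  apply: (row_free_inj freeB); rewrite /= mul0mx mulmx_suml.
  by rewrite (eq_bigr _ homB) -mulmx_sumr [X in B *m X]norm0 mulmx0.
apply/matrixP=> i j.
have E: norm_mx rD (lshift _ (lshift _ i)) (lshift _ (lshift _ j)) = 0.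
  by rewrite normD0 mxE.
rewrite [RHS]mxE -{}E /norm_mx !summxE.
by apply: eq_bigr => s _; rewrite /= !block_mxEul.
Qed.

(* If some v has a nonzero norm, then 1 |-> v embeds the regular module; a    *)
(* functional not vanishing on the norm of v induces a map back whose         *)
(* composite with this embedding is injective on the socle of the regular     *)
(* module, hence bijective.                                                   *)
Lemma norm_free_summand n (rV : mx_representation F S n) :
  norm_mx rV != 0 -> has_free_summand rV.
Proof.
case/rowV0Pn=> w /submxP[v Dw] nzw.
have [lam lamw] : exists lam : 'cV[F]_n, w *m lam = 1%:M.
  by apply/row_freeP; rewrite /row_free rank_rV nzw.
pose f : 'M[F]_(#|S|, n) := \matrix_i (v *m rV (enum_val i)).
pose r : 'M[F]_(n, #|S|) := \matrix_(i, j) (rV (enum_val j)^-1%g *m lam) i 0.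
have rE i j : r i j = (rV (enum_val j)^-1%g *m lam) i 0 by rewrite mxE.
have aSE x i j : aS x i j = (j == gring_index S (enum_val i * x)%g)%:R.
  by rewrite !mxE eqxx.
have homf : mx_intertwines aS rV f.
  move=> x Sx; apply/row_matrixP=> i; rewrite !row_mul !rowK -rowE rowK.
  by rewrite gring_indexK ?groupM ?enum_valP // repr_mxM ?enum_valP // mulmxA.
have homr : mx_intertwines rV aS r.
  move=> x Sx; apply/matrixP=> i j; pose k := gring_index S (enum_val j * x^-1)%g.
  have Dk: enum_val k = (enum_val j * x^-1)%g.
    by rewrite gring_indexK ?groupM ?groupV ?enum_valP.
  rewrite [RHS]mxE (bigD1 k) //= big1 ?addr0 => [|l nkl].
    rewrite rE aSE Dk mulgKV gring_valK eqxx mulr1 invMg invgK.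
    rewrite repr_mxM ?groupV ?enum_valP // -mulmxA [LHS]mxE [RHS]mxE.
    by apply: eq_bigr => l _; rewrite rE.
  rewrite aSE; case: eqP => [Dj | _]; last by rewrite mulr0.
  case/eqP: nkl; apply: enum_val_inj; rewrite Dk Dj gring_indexK ?mulgK //.
  by rewrite groupM ?enum_valP.
have homfr := intertwines_comp homf homr.
have sum_f (e : 'rV_#|S|) : e = const_mx 1 -> e *m f = w.
  move=> ->; rewrite mulmx_sum_row Dw mulmx_sumr (reindex (@enum_val _ S)) /=.
    by apply: eq_big => [i | i _]; rewrite ?enum_valP // mxE scale1r rowK.
  by exists (gring_index S) => x Sx; [rewrite gring_valK | rewrite gring_indexK].
have w_r : w *m r = const_mx 1.
  apply/rowP=> j; rewrite [LHS]mxE [RHS]mxE.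
  transitivity ((w *m rV (enum_val j)^-1%g *m lam) 0 0).
    by rewrite -mulmxA [RHS]mxE; apply: eq_bigr => l _; rewrite rE.
  by rewrite {1}Dw -(mulmxA v) norm_mxMr ?groupV ?enum_valP // -Dw lamw mxE.
have fr_free : row_free (f *m r).
  rewrite -kermx_eq0; apply: contraT => nzk.
  have modk := intertwines_ker_module homfr.
  have rk : (0 < \rank (kermx (f *m r)))%N by rewrite lt0n mxrank_eq0.
  have := rfix_pgroup_pchar charFp (submod_repr modk) rk pS (subxx _).
  rewrite -mxrank_eq0 (rfix_submod modk) // mxrank_in_submod ?capmxSl // mxrank_eq0.
  case/rowV0Pn=> u; rewrite sub_capmx => /andP[/sub_kermxP uk].
  (* Fixed vectors of the regular module are multiples of the sum of [S], which [f] sends to [w] and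
     [r] then sends to the all-ones vector. *)
  rewrite rfix_regular => /sub_rVP[c Du] nzu.
  case/eqP: nzu; move: uk; rewrite Du.
  have ->: gring_row (gset_mx F S S) = const_mx 1.
    apply/rowP=> j; rewrite mxE summxE (bigD1 (enum_val j)) ?enum_valP //= big1 ?addr0.
      by rewrite aSE gring_indexK // mul1g gring_valK eqxx mxE.
    move=> x /andP[Sx nxj]; rewrite aSE gring_indexK // mul1g.
    by case: eqP => // Dj; case/eqP: nxj; rewrite Dj gring_indexK.
  by rewrite -scalemxAl mulmxA sum_f // w_r.
have f_free : row_free f.
  by rewrite /row_free eqn_leq rank_leq_row -{1}(eqP fr_free) mxrankM_maxl.
have mod_f := intertwines_im_module homf (mxmodule1 aS).
have mod_k := intertwines_ker_module homr.
have mod_f' : mxmodule rV <<f>>%MS by rewrite (eqmx_module _ (genmxE f)) -[f]mul1mx.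
have mod_0 : mxmodule rV (0 : 'M_n) := mxmodule0 _ _.
have dx : mxdirect (<<f>> + kermx r).
  apply/mxdirect_addsP/eqP/rowV0P=> u.
  rewrite sub_capmx genmxE => /andP[/submxP[a ->] /sub_kermxP].
  by rewrite -mulmxA => /eqP; rewrite mulmx_free_eq0 // => /eqP->; rewrite mul0mx.
have full : (<<f>> + kermx r :=: 1%:M)%MS.
  apply/eqmxP; rewrite submx1 sub1mx /row_full (mxdirectP dx) /= mxrank_gen.
  rewrite (eqP f_free) mxrank_ker eqn_leq -{1}(eqP f_free).
  have := rank_leq_col (<<f>> + kermx r)%MS.
  rewrite (mxdirectP dx) /= mxrank_gen mxrank_ker => ->.
  by rewrite addnBA ?rank_leq_row // addnC -addnBA ?leq_addr // rank_leq_col.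
have sim_f : mx_rsim (submod_repr mod_f') (Representation aS).
  apply: mx_rsim_sym; exists (in_submod <<f>>%MS f) => [||x Sx].
  - by rewrite mxrank_gen (eqP f_free).
  - by rewrite /row_free mxrank_in_submod ?genmxE // (eqP f_free).
  by rewrite -in_submodJ ?genmxE // -homf // [LHS]mulmxA.
have sim_0 : mx_rsim (submod_repr mod_0) (@grepr0 F gT S).
  by exists 0 => [||x _]; rewrite ?mulmx0 ?mul0mx // ?/row_free ?mxrank0.
(* A single copy under [muln_grepr] unfolds to the regular module plus the zero module; [mod_0] and
   [sim_0] account for the latter. *)
exists 1%N, (Representation (submod_repr mod_k)); split=> //.
rewrite /muln_grepr big_ord_recl big_ord0.
have mod_1 := mxmodule1 rV.
apply: mx_rsim_trans (mx_rsim_sym (rsim_submod1 mod_1 (eqmx_refl _))) _.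
apply: (mx_rsim_dadd (modU := mod_f') (modV := mod_k)) => //; last exact: mx_rsim_refl.
apply: (mx_rsim_dadd (modU := mod_f') (modV := mod_0)) => //.
  exact: addsmx0.
by apply/mxdirect_addsP; rewrite capmx0.
Qed.

End FreeSummands.

(** * Simple modules lying over a simple module of a normal subgroup *)

Section Clifford.

Variables (F : closedFieldType) (aT rT : finGroupType) (P : {group aT}).
Variables (K : {group rT}) (to : groupAction P K).

(** Such a pair is a module over K x| S. Keeping the two actions apart lets subgroups S of P share
    the one action [to], without changing groups. *)
Definition compatible n (S : {group aT}) (rK : mx_representation F K n)
    (rS : mx_representation F S n) : Prop :=
  {in K & S, forall x a, rK x *m rS a = rS a *m rK (to x a)}.

Definition pair_irreducible n (S : {group aT}) (rK : mx_representation F K n)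
    (rS : mx_representation F S n) : Prop :=
  (0 < n)%N /\
  forall U : 'M_n, mxmodule rK U -> mxmodule rS U -> U != 0 -> row_full U.

(** For simple [rU] this says that [a] lies in the inertia group: the twist of [rU] by [a] is
    isomorphic to [rU]. *)
Definition stabilizes m (rU : mx_representation F K m) (a : aT) : Prop :=
  exists2 A : 'M_m, A != 0 & {in K, forall x, rU x *m A = A *m rU (to x a)}.

Let toK x a : x \in K -> a \in P -> to x a \in K.
Proof. by move=> Kx Pa; rewrite gact_stable. Qed.

Let toM x a b : a \in P -> b \in P -> to (to x a) b = to x (a * b)%g.
Proof. by move=> Pa Pb; rewrite actMin. Qed.

(** Twisting by [a] only permutes the operators [rU x], so submodules of the image pull back along
    [f] to submodules of [rU]. *)
Lemma twisted_simple m n (rU : mx_representation F K m)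
    (rK : mx_representation F K n) (f : 'M_(m, n)) a :
    mx_irreducible rU -> row_free f -> a \in P ->
    {in K, forall x, rU x *m f = f *m rK (to x a)} ->
  mxsimple rK <<f>>%MS.
Proof.
move=> /mx_irrP[m_gt0 irrU] freef Pa homf.
have homfV x : x \in K -> f *m rK x = rU (to x a^-1%g) *m f.
  by move=> Kx; rewrite homf ?toK ?toM ?groupV // mulVg act1.
split=> [||W modW sWf nzW].
- rewrite (eqmx_module _ (genmxE f)); apply/mxmoduleP=> x Kx.
  by rewrite homfV ?submxMl.
- by rewrite (eqmx_eq0 (genmxE f)) -mxrank_eq0 (eqP freef) -lt0n.
rewrite genmxE in sWf *; case/submxP: sWf => B DW; rewrite {W}DW in modW nzW *.
have: row_full <<B>>%MS.
  apply: irrU; last first.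
    by rewrite (eqmx_eq0 (genmxE B)); apply: contraNneq nzW => ->; rewrite mul0mx.
  rewrite (eqmx_module _ (genmxE B)); apply/mxmoduleP=> x Kx.
  rewrite -(submxMfree _ _ freef) -mulmxA homf // mulmxA.
  by rewrite (mxmoduleP modW) ?toK.
by rewrite -sub1mx !genmxE => /(submxMr f); rewrite mul1mx.
Qed.

Section Translates.

Variables (m n : nat) (S : {group aT}) (rU : mx_representation F K m).
Variables (rK : mx_representation F K n) (rS : mx_representation F S n).
Hypotheses (sSP : S \subset P) (irrU : mx_irreducible rU) (cKS : compatible rK rS).

Implicit Types e : 'M[F]_(m, n).

Lemma intertwines_translate e a : mx_intertwines rU rK e -> a \in S ->
  {in K, forall x, rU x *m (e *m rS a) = e *m rS a *m rK (to x a)}.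
Proof. by move=> home Sa x Kx; rewrite mulmxA home // -!mulmxA cKS. Qed.

Lemma translate_free e a :
  mx_intertwines rU rK e -> e != 0 -> a \in S -> row_free (e *m rS a).
Proof.
move=> home nze Sa; rewrite /row_free mxrankMfree ?repr_mx_free //.
exact: irr_intertwines_free home irrU nze.
Qed.

Lemma translate_simple e a :
  mx_intertwines rU rK e -> e != 0 -> a \in S -> mxsimple rK <<e *m rS a>>%MS.
Proof.
move=> home nze Sa; apply: (@twisted_simple _ _ rU _ _ a) => //.
- exact: translate_free.
- exact: subsetP sSP a Sa.
exact: intertwines_translate.
Qed.

Definition translates e (I : {set aT}) := (\sum_(a in I) <<e *m rS a>>)%MS.

Lemma translate_sub e (I : {set aT}) a : a \in I -> (e *m rS a <= translates e I)%MS.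
Proof. by move=> Ia; rewrite (sumsmx_sup a) ?genmxE. Qed.

Lemma translates_module e (I : {set aT}) : mx_intertwines rU rK e -> e != 0 ->
  I \subset S -> mxmodule rK (translates e I).
Proof.
move=> home nze sIS; apply: sumsmx_module => a Ia.
by apply: mxsimple_module; apply: translate_simple => //; apply: (subsetP sIS).
Qed.

Lemma translates_full e : pair_irreducible rK rS ->
  mx_intertwines rU rK e -> e != 0 -> (translates e S :=: 1%:M)%MS.
Proof.
case=> n_gt0 irrV home nze; apply/eqmxP; rewrite submx1 sub1mx; apply: irrV.
- exact: translates_module.
- apply/mxmoduleP=> b Sb; rewrite sumsmxMr; apply/sumsmx_subP=> a Sa.
  rewrite (eqmxMr _ (genmxE _)) -mulmxA -repr_mxM //.
  by rewrite translate_sub ?groupM.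
have [_ nzT _] := translate_simple home nze (group1 S).
by apply: contraNneq nzT => T0; rewrite -submx0 genmxE -T0 translate_sub.
Qed.

(** Clifford's theorem: the translates of a simple K-submodule are simple and span. *)
Lemma pair_semisimple e : pair_irreducible rK rS ->
  mx_intertwines rU rK e -> e != 0 -> mxsemisimple rK 1%:M.
Proof.
move=> irrV home nze.
apply: (intro_mxsemisimple (translates_full irrV home nze)) => a Sa _.
exact: translate_simple.
Qed.

(** A simple submodule of a sum of simple modules is isomorphic to one of them. Here the twists of U
    by [a] and by some [b] agree, and the isomorphism read on U is the required matrix. *)
Lemma translate_sub_stabilizes e e' a (I : {set aT}) :
    mx_intertwines rU rK e -> e != 0 -> mx_intertwines rU rK e' -> e' != 0 ->
    a \in S -> I \subset S -> (e' *m rS a <= translates e I)%MS ->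
  exists2 b, b \in I & stabilizes rU (a * b^-1)%g.
Proof.
move=> home nze home' nze' Sa sIS sub_e'.
have sub1 : (<<e' *m rS a>> <= translates e I *m 1%:M)%MS by rewrite mulmx1 genmxE.
have [b Ib _ | b Ib iso_b] := hom_mxsemisimple_iso (translate_simple home' nze' Sa)
   _ (scalar_mx_hom rK 1 _) sub1.
  by apply: translate_simple => //; apply: (subsetP sIS).
have Sb := subsetP sIS b Ib; exists b => //.
have [f0 uf0 hom_f0 def_f0] := mx_iso_sym iso_b.
have /submxP[B DB]: (e' *m rS a *m f0 <= e *m rS b)%MS.
  by rewrite -(genmxE (e *m rS b)) -def_f0 submxMr ?genmxE.
have [Pa Pb] := (subsetP sSP a Sa, subsetP sSP b Sb).
exists B => [|x Kx].
  apply: contraTneq (translate_free home' nze' Sa) => B0.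
  move: DB; rewrite B0 mul0mx => /(canRL (mulmxK uf0)); rewrite mul0mx => ->.
  rewrite /row_free mxrank0 eq_sym -lt0n; by case/mx_irrP: irrU.
apply: (row_free_inj (translate_free home nze Sb)) => /=.
have homW: (e' *m rS a <= dom_hom_mx rK f0)%MS.
  by apply: submx_trans hom_f0; rewrite genmxE.
have Kxa := toK Kx Pa.
have Kxab : to x (a * b^-1)%g \in K by rewrite toK ?groupM ?groupV.
rewrite -(mulmxA B) (intertwines_translate home Sb Kxab).
rewrite toM ?groupM ?groupV // mulgKV [RHS]mulmxA -DB -(hom_mxP homW) //.
by rewrite -(intertwines_translate home' Sa) // -(mulmxA _ B) -DB [LHS]mulmxA.
Qed.

Lemma translates_disjoint e (I J : {set aT}) :
    mx_intertwines rU rK e -> e != 0 -> I \subset S -> J \subset S ->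
    {in I & J, forall a b, ~ stabilizes rU (a * b^-1)%g} ->
  (translates e I :&: translates e J)%MS = 0.
Proof.
move=> home nze sIS sJS nostab; apply/eqP/idPn=> nzIJ.
have modIJ : mxmodule rK (translates e I :&: translates e J)%MS.
  by rewrite capmx_module ?translates_module.
have [Z simZ] := dec_mxsimple_exists modIJ nzIJ.
rewrite sub_capmx -{1}[translates e I]mulmx1 => /andP[sZI sZJ].
have [a Ia _ | a Ia iso_a] := hom_mxsemisimple_iso simZ _ (scalar_mx_hom rK 1 _) sZI.
  by apply: translate_simple => //; apply: (subsetP sIS).
have Sa := subsetP sIS a Ia; have Pa := subsetP sSP a Sa.
have [f0 uf0 hom_f0 def_f0] := iso_a.
have homW: (e *m rS a <= dom_hom_mx rK f0)%MS.
  by apply: submx_trans hom_f0; rewrite genmxE.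
(* Undoing the translation by [a] turns the isomorphism onto [Z] into a K-embedding [e'] of U whose
   translate by [a] has image [Z]. *)
pose e' := e *m rS a *m f0 *m rS a^-1%g.
have De' : e' *m rS a = e *m rS a *m f0 by rewrite repr_mxKV.
have home' : mx_intertwines rU rK e'.
  move=> x Kx; have Kxa := toK Kx Pa.
  rewrite /e' -(mulmxA _ (rS a^-1%g)) -{2}[x](actKin to Pa) -cKS ?groupV //.
  rewrite [RHS]mulmxA -(hom_mxP homW) // -(intertwines_translate home Sa) //.
  by rewrite !mulmxA.
have nze' : e' != 0.
  apply: contraTneq (translate_free home nze Sa) => e'0.
  move/esym: De'; rewrite e'0 mul0mx => /(canRL (mulmxK uf0)); rewrite mul0mx => ->.
  rewrite /row_free mxrank0 eq_sym -lt0n; by case/mx_irrP: irrU.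
have [|b Jb] := translate_sub_stabilizes home nze home' nze' Sa sJS _.
  by apply: submx_trans sZJ; rewrite De' -def_f0 submxMr ?genmxE.
exact: nostab.
Qed.

End Translates.

Lemma stabilizes_unit m (rU : mx_representation F K m) a (A : 'M_m) :
    mx_irreducible rU -> a \in P -> A != 0 ->
    {in K, forall x, rU x *m A = A *m rU (to x a)} ->
  A \in unitmx.
Proof.
move=> irrU Pa nzA homA; rewrite -row_free_unit -kermx_eq0.
apply: contraNT nzA => nzk; have [_ /(_ (kermx A))] := iffLR (mx_irrP rU) irrU.
rewrite -sub1mx => fullk; rewrite -[A]mul1mx; apply/eqP/sub_kermxP/fullk => //.
apply/mxmoduleP=> x Kx; apply/sub_kermxP.
by rewrite -mulmxA homA // mulmxA mulmx_ker mul0mx.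
Qed.

Section CommonConstituent.

Variables (m n n' : nat) (S : {group aT}) (rU : mx_representation F K m).
Variables (rK : mx_representation F K n) (rS : mx_representation F S n).
Variables (rK' : mx_representation F K n') (rS' : mx_representation F S n').
Hypotheses (sSP : S \subset P) (irrU : mx_irreducible rU).
Hypotheses (cKS : compatible rK rS) (cKS' : compatible rK' rS').

Lemma pgroup_pair_intertwiner p f0 :
    p \in [pchar F] -> p.-group S -> mx_intertwines rK rK' f0 -> f0 != 0 ->
  exists f, [/\ f != 0, mx_intertwines rK rK' f & mx_intertwines rS rS' f].
Proof.
move=> charFp pS homf0 nzf0.
have [c /= []] := pgroup_intertwiner charFp pS rS rS' nzf0.
set g := \sum_(a in S) _ => nzg homg; exists g; split=> // x Kx.
rewrite mulmx_sumr mulmx_suml; apply: eq_bigr => a Sa; have Pa := subsetP sSP a Sa.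
rewrite -scalemxAr -scalemxAl; congr (_ *: _); rewrite -[RHS]mulmxA.
have Kxa : to x a^-1%g \in K by rewrite toK ?groupV.
have Dx : x = to (to x a^-1%g) a by rewrite toM ?groupV // mulVg act1.
rewrite {2}Dx -cKS' // !mulmxA cKS ?groupV //; congr (_ *m _).
by rewrite -!mulmxA homf0.
Qed.

(** By semisimplicity over K, [e] has a K-retraction [r]; the nonzero K-map [r *m e'] is then made
    S-equivariant, using that S is a p-group. *)
Lemma pair_common_constituent p (e : 'M_(m, n)) (e' : 'M_(m, n')) :
    p \in [pchar F] -> p.-group S -> pair_irreducible rK rS ->
    mx_intertwines rU rK e -> e != 0 -> mx_intertwines rU rK' e' -> e' != 0 ->
  exists f, [/\ f != 0, mx_intertwines rK rK' f & mx_intertwines rS rS' f].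
Proof.
move=> charFp pS irrV home nze home' nze'.
have freee := irr_intertwines_free home irrU nze.
have modE : mxmodule rK <<e>>%MS.
  by rewrite (eqmx_module _ (genmxE e)) -[e]mul1mx (intertwines_im_module home) ?mxmodule1.
have ssV := pair_semisimple sSP irrU cKS irrV home nze.
have [W modW defEW dxEW] := mxsemisimple_reducible ssV modE (submx1 _).
have tiEW := mxdirect_addsP dxEW.
pose pr := proj_mx <<e>>%MS W; pose r := pr *m pinvmx e.
have hompr x : x \in K -> rK x *m pr = pr *m rK x.
  move=> Kx; have hom1: (1%:M <= dom_hom_mx rK pr)%MS.
    by rewrite -defEW proj_mx_hom.
  by have := hom_mxP hom1 x Kx; rewrite !mul1mx.
have re : r *m e = pr.
  by rewrite mulmxKpV // -(genmxE e) -[pr]mul1mx proj_mx_sub.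
have homr : mx_intertwines rK rU r.
  move=> x Kx; apply: (row_free_inj freee).
  by rewrite /= -(mulmxA _ r) re -(mulmxA r) home // [RHS]mulmxA re hompr.
have er : e *m r = 1%:M.
  apply: (row_free_inj freee); rewrite /= -mulmxA re mul1mx.
  by apply: proj_mx_id => //; rewrite genmxE.
apply: (@pgroup_pair_intertwiner p (r *m e')) => //.
  exact: intertwines_comp homr home'.
by apply: contraNneq nze' => re'0; rewrite -[e']mul1mx -er -mulmxA re'0 mulmx0.
Qed.

Lemma pair_intertwines_free f : pair_irreducible rK rS ->
  mx_intertwines rK rK' f -> mx_intertwines rS rS' f -> f != 0 -> row_free f.
Proof.
case=> _ irrV homK homS nzf; rewrite -kermx_eq0; apply: contraNT nzf => nzk.
have := irrV _ (intertwines_ker_module homK) (intertwines_ker_module homS) nzk.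
by rewrite -sub1mx => /sub_kermxP; rewrite mul1mx => ->.
Qed.

End CommonConstituent.

(** The translates of U span V, and multiplying the norm on the left by a group element does not
    change it. *)
Lemma norm_mx_translates m n (S : {group aT}) (rU : mx_representation F K m)
    (rK : mx_representation F K n) (rS : mx_representation F S n) (e : 'M_(m, n)) :
    S \subset P -> mx_irreducible rU -> compatible rK rS -> pair_irreducible rK rS ->
    mx_intertwines rU rK e -> e != 0 ->
  (norm_mx rS == 0) = (e *m norm_mx rS == 0).
Proof.
move=> sSP irrU cKS irrV home nze; apply/eqP/eqP=> [-> | e0]; first by rewrite mulmx0.
apply/eqP; rewrite -[norm_mx rS]mul1mx -submx0.
rewrite -(eqmxMr _ (translates_full sSP irrU cKS irrV home nze)) sumsmxMr.
apply/sumsmx_subP=> a Sa; rewrite (eqmxMr _ (genmxE _)) -mulmxA.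
suffices ->: rS a *m norm_mx rS = norm_mx rS by rewrite e0 sub0mx.
rewrite /norm_mx mulmx_sumr [RHS](reindex_inj (mulgI a)) /=.
by apply: eq_big => s; [rewrite groupMl | move=> Ss; rewrite repr_mxM].
Qed.

Lemma norm_mx_subgroup n (S : {group aT}) (rP : mx_representation F P n)
    (sSP : S \subset P) k (e : 'M_(k, n)) :
  e *m norm_mx (subg_repr rP sSP) = 0 -> e *m norm_mx rP = 0.
Proof.
move=> e0; rewrite /norm_mx (set_partition_big _ (rcosets_partition sSP)) /=.
rewrite mulmx_sumr big1 // => _ /rcosetsP[c Pc ->].
rewrite (reindex_inj (mulIg c)) /=.
rewrite (eq_bigl (mem S)) => [|s]; last by rewrite mem_rcoset mulgK.
rewrite (eq_bigr (fun s => rP s *m rP c)) => [|s Ss]; last first.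
  by rewrite repr_mxM // (subsetP sSP).
by rewrite -mulmx_suml mulmxA [e *m _]e0 mul0mx.
Qed.

(* V' is induced from the submodule generated by the image of V: the norm of  *)
(* P is the norm of S followed by translations by coset representatives, which *)
(* are linearly independent on that submodule.                                *)
Lemma norm_mx_pair_iff p m n n' (S : {group aT}) (rU : mx_representation F K m)
    (rK : mx_representation F K n) (rS : mx_representation F S n)
    (rK' : mx_representation F K n') (rP : mx_representation F P n')
    (e : 'M_(m, n)) (e' : 'M_(m, n')) :
    p \in [pchar F] -> p.-group P -> S \subset P -> mx_irreducible rU ->
    {in P, forall a, stabilizes rU a -> a \in S} ->
    compatible rK rS -> compatible rK' rP ->
    pair_irreducible rK rS -> pair_irreducible rK' rP ->
    mx_intertwines rU rK e -> e != 0 -> mx_intertwines rU rK' e' -> e' != 0 ->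
  (norm_mx rS == 0) = (norm_mx rP == 0).
Proof.
move=> charFp pP sSP irrU stabS cKS cKP irrV irrV' home nze home' nze'.
pose rS' := subg_repr rP sSP.
have cKS' : compatible rK' rS' by move=> x a Kx Sa; apply: cKP => //; apply: (subsetP sSP).
have [f [nzf homKf homSf]] := pair_common_constituent sSP irrU cKS cKS' charFp
  (pgroupS sSP pP) irrV home nze home' nze'.
have freef := pair_intertwines_free irrV homKf homSf nzf.
pose h := e *m f; have homh : mx_intertwines rU rK' h by apply: intertwines_comp home homKf.
have nzh : h != 0 by rewrite mulmx_free_eq0.
rewrite (norm_mx_translates sSP irrU cKS irrV home nze).
rewrite (norm_mx_translates (subxx P) irrU cKP irrV' homh nzh).
rewrite -(mulmx_free_eq0 _ freef).
have ->: e *m norm_mx rS *m f = h *m norm_mx rS'.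
  rewrite -!mulmxA; congr (_ *m _); rewrite mulmx_suml mulmx_sumr.
  by apply: eq_bigr => a Sa; apply: homSf.
apply/eqP/eqP=> [|h0]; first exact: norm_mx_subgroup.
(* If the norm of P kills [h], the part from S is minus the part from P \ S, so it lies in two sums
   of translates that meet in 0. *)
apply/eqP; rewrite -submx0.
rewrite -(translates_disjoint (subxx P) irrU cKP homh nzh sSP (subsetDl P S)); last first.
  move=> a b Sa /setDP[Pb nSb] /stabS; rewrite groupM ?groupV ?(subsetP sSP a) // => /(_ isT).
  by rewrite groupMl // groupV (negPf nSb).
rewrite sub_capmx; apply/andP; split.
  rewrite mulmx_sumr; apply: summx_sub => a Sa; exact: translate_sub.
move: h0; rewrite /norm_mx (big_setID S) /= (setIidPr sSP) mulmxDr.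
move/(canRL (addrK _)); rewrite sub0r => ->; rewrite eqmx_opp mulmx_sumr.
by apply: summx_sub => a PSa; apply: translate_sub.
Qed.

(* The stabilizer T of U acts projectively, hence linearly, on U; the p-group *)
(* T fixes a nonzero K-homomorphism from U to V, whose image is therefore the *)
(* whole U-isotypic part of V.                                                *)
Lemma pair_multiplicity_one p m n (rU : mx_representation F K m)
    (rK : mx_representation F K n) (rP : mx_representation F P n) (e e' : 'M_(m, n)) :
    p \in [pchar F] -> p.-group P -> mx_irreducible rU ->
    compatible rK rP -> pair_irreducible rK rP ->
    mx_intertwines rU rK e -> e != 0 -> mx_intertwines rU rK e' ->
  exists c, e' = c *: e.
Proof.
move=> charFp pP irrU cKP irrV home nze home'.
case: m => [|m] in rU irrU e home nze e' home' *; first by case/mx_irrP: irrU.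
suffices [g nzg multg]: exists2 g : 'M_(m.+1, n), g != 0 &
    forall h, mx_intertwines rU rK h -> exists c, h = c *: g.
  have [[c Dc] [c' Dc']] := (multg e home, multg e' home').
  exists (c' / c); rewrite Dc Dc' scalerA mulfVK //.
  by apply: contraNneq nze => c0; rewrite Dc c0 scale0r.
(* [stabilizes] is a proposition; a classical boolean version is needed to form the set [T]. *)
have [T0 T0P]: exists T0 : aT -> bool, forall a, T0 a <-> stabilizes rU a.
  have D0 a : exists b : bool, b <-> stabilizes rU a.
    by have [sa | nsa] := classic (stabilizes rU a); [exists true | exists false].
  by have [T0 T0P] := fin_all_exists D0; exists T0.
pose T := [set a in P | T0 a].
have TP a : reflect (a \in P /\ stabilizes rU a) (a \in T).
  by rewrite inE; apply: (iffP andP) => -[Pa /T0P].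
have gT : group_set T.
  apply/group_setP; split=> [|a b /TP[Pa [A nzA homA]] /TP[Pb [B nzB homB]]].
    apply/TP; split=> //; exists 1%:M => [|x Kx]; first exact: oner_neq0.
    by rewrite act1 mulmx1 mul1mx.
  apply/TP; split; first exact: groupM; exists (A *m B) => [|x Kx].
    by rewrite mulmx_free_eq0 // row_free_unit (stabilizes_unit irrU Pb nzB homB).
  by rewrite mulmxA homA // -!mulmxA homB ?toK // toM.
pose TG := Group gT; have sTP : TG \subset P by apply/subsetP=> a /TP[].
have [A homA]: exists A : aT -> 'M[F]_m.+1, forall a, a \in T ->
    A a \in unitmx /\ {in K, forall x, rU x *m A a = A a *m rU (to x a)}.
  have D0 a : exists Aa : 'M[F]_m.+1, a \in T ->
    Aa \in unitmx /\ {in K, forall x, rU x *m Aa = Aa *m rU (to x a)}.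
    have [Ta | nTa] := boolP (a \in T); last by exists 0.
    have [Pa [Aa nzA homA]] := TP a Ta; exists Aa => _; split=> //.
    exact: stabilizes_unit homA.
  by have [A AP] := fin_all_exists D0; exists A.
have uA a : a \in T -> A a \in unitmx by case/homA.
have abs_irr : mx_absolutely_irreducible rU by apply: group_closure_closed_field.
have projA : {in TG &, forall a b, exists c, A a *m A b = c *: A (a * b)%g}.
  move=> a b Ta Tb; have Tab : (a * b)%g \in TG by rewrite groupM.
  have [[Pa _] [Pb _]] := (TP a Ta, TP b Tb).
  have [_ ha] := homA a Ta; have [_ hb] := homA b Tb; have [uab hab] := homA _ Tab.
  have cUB : centgmx rU (A a *m A b *m invmx (A (a * b)%g)).
    apply/centgmxP=> x Kx; apply: (can_inj (mulmxK uab)); rewrite /=.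
    rewrite -[LHS]mulmxA hab // [LHS]mulmxA mulmxKV // -[RHS]mulmxA mulmxKV //.
    by rewrite [RHS]mulmxA ha // -!mulmxA hb ?toK // toM.
  have /is_scalar_mxP[c Dc] := mx_abs_irr_cent_scalar abs_irr cUB.
  by exists c; rewrite -mul_scalar_mx -Dc mulmxKV.
have [b nzb bA] := pgroup_projective_lift charFp (pgroupS sTP pP) uA projA.
pose rA := MxRepresentation bA.
have [c /= []] := pgroup_intertwiner charFp (pgroupS sTP pP) rA (subg_repr rP sTP) nze.
set g := \sum_(a in _) _ => nzg homTg; exists g => // h homh.
have homg : mx_intertwines rU rK g.
  move=> x Kx; rewrite mulmx_sumr mulmx_suml; apply: eq_bigr => a Ta.
  have [Pa _] := TP a Ta; have TVa : a^-1%g \in TG by rewrite groupV.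
  rewrite -scalemxAr -scalemxAl; congr (_ *: _); rewrite -[RHS]mulmxA.
  have Kxa : to x a^-1%g \in K by rewrite toK ?groupV.
  have Dx : x = to (to x a^-1%g) a by rewrite toM ?groupV // mulVg act1.
  rewrite {2}Dx -cKP // !mulmxA; congr (_ *m _).
  have [_ ha] := homA _ TVa.
  by rewrite -scalemxAr -!scalemxAl ha // -!mulmxA home.
have tiM : (translates rP g (P :\: T) :&: translates rP g T)%MS = 0.
  apply: (translates_disjoint (subxx P) irrU cKP homg nzg) => //; first exact: subsetDl.
  move=> a d /setDP[Pa nTa] Td; have [Pd _] := TP d Td => sad.
  have: (a * d^-1)%g \in TG by apply/TP; rewrite groupM ?groupV.
  by rewrite groupMr ?groupV // inE; move: nTa; rewrite inE => /negPf->.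
have modM := translates_module (subxx P) irrU cKP homg nzg sTP.
have modN := translates_module (subxx P) irrU cKP homg nzg (subsetDl P T).
set M := translates rP g T in tiM modM; set N := translates rP g _ in tiM modN.
have fullNM : (1%:M <= N + M)%MS.
  rewrite -(translates_full (subxx P) irrU cKP irrV homg nzg).
  apply/sumsmx_subP=> a Pa; rewrite genmxE; have [Ta | nTa] := boolP (a \in T).
    by rewrite (submx_trans _ (addsmxSr _ _)) ?translate_sub.
  by rewrite (submx_trans _ (addsmxSl _ _)) ?translate_sub // inE nTa.
(* [g] is T-equivariant, so translating it by T does not leave its image. *)
have sMg : (M <= g)%MS.
  by apply/sumsmx_subP=> a Ta; rewrite genmxE -[rP a]/(subg_repr rP sTP a) -homTg ?submxMl.
(* A nonzero K-map from U into [N] would make U isomorphic to a twist by an element outside T. *)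
have hN0 : h *m proj_mx N M = 0.
  have homp x : x \in K -> rK x *m proj_mx N M = proj_mx N M *m rK x.
    move=> Kx; have hom1: (1%:M <= dom_hom_mx rK (proj_mx N M))%MS.
      by apply: submx_trans fullNM _; apply: proj_mx_hom.
    by have := hom_mxP hom1 x Kx; rewrite !mul1mx.
  apply: contraTeq isT => nzq; have homq : mx_intertwines rU rK (h *m proj_mx N M).
    by move=> x Kx; rewrite mulmxA homh // -(mulmxA h) homp // mulmxA.
  have [|d /setDP[Pd nTd]] := translate_sub_stabilizes (subxx P) irrU cKP homg nzg homq nzq
    (group1 P) (subsetDl P T).
    by rewrite repr_mx1 mulmx1 proj_mx_sub.
  rewrite mul1g => sd; case/negP: nTd; rewrite -(groupV TG).
  by apply/TP; rewrite groupV.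
have shg : (h <= g)%MS.
  apply: submx_trans sMg; rewrite -(add_proj_mx tiM (submx_trans (submx1 h) fullNM)).
  by rewrite hN0 add0r proj_mx_sub.
exact: intertwines_scalar irrU homg homh (irr_intertwines_free homg irrU nzg) shg.
Qed.

End Clifford.

(** * Projective covers and modules induced to a semidirect product *)

(** The point is that [k] kills X = ker [f]. Let C be a complement of the image of X in the
    semisimple target; the preimage of C together with X is everything, so by essentiality the
    preimage is everything, and the image of X lies in C, hence is 0. *)
Lemma cover_factor (F : fieldType) (gT : finGroupType) (G : {group gT}) d m n
    (rE : mx_representation F G d) (rU : mx_representation F G m)
    (rW : mx_representation F G n) (f : 'M_(d, m)) (k : 'M_(d, n)) :
    mx_intertwines rE rU f -> row_full f ->
    (forall U : 'M_d, mxmodule rE U -> (1%:M <= U + kermx f)%MS -> (1%:M <= U)%MS) ->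
    mxsemisimple rW 1%:M -> mx_intertwines rE rW k ->
  exists2 h, mx_intertwines rU rW h & k = f *m h.
Proof.
move=> homf fullf essf ssW homk; pose X := kermx f.
have modX : mxmodule rE X := intertwines_ker_module homf.
have modY : mxmodule rW <<X *m k>>%MS.
  by rewrite (eqmx_module _ (genmxE _)) (intertwines_im_module homk).
have [C modC defYC dxYC] := mxsemisimple_reducible ssW modY (submx1 _).
have tiYC := mxdirect_addsP dxYC.
pose Z := kermx (k *m cokermx C).
have ZP r (W : 'M_(r, d)) : (W <= Z)%MS = (W *m k <= C)%MS.
  by rewrite sub_kermx [in RHS]submxE mulmxA.
have modZ : mxmodule rE Z.
  apply/mxmoduleP=> x Gx; rewrite ZP -mulmxA homk // mulmxA.
  apply: submx_trans (mxmoduleP modC x Gx); rewrite submxMr // -ZP.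
  exact: submx_refl.
have sub1 : (1%:M <= Z + X)%MS.
  have /submxP[B DB] : (k *m proj_mx <<X *m k>>%MS C <= X *m k)%MS.
    by rewrite -(genmxE (X *m k)) proj_mx_sub.
  rewrite -[1%:M](subrK (B *m X)) addmx_sub_adds ?submxMl // ZP.
  rewrite mulmxBl mul1mx -mulmxA -DB.
  have sk1 : (k <= <<X *m k>> + C)%MS by rewrite defYC submx1.
  by rewrite -{1}(add_proj_mx tiYC sk1) addrAC subrr add0r proj_mx_sub.
have := essf Z modZ sub1; rewrite ZP mul1mx => skC.
have Xk0 : X *m k = 0.
  apply/eqP; rewrite -submx0 -tiYC sub_capmx genmxE submx_refl /=.
  by rewrite mulmx_sub.
have ff : pinvmx f *m f = 1%:M by rewrite mulVpmx.
have Dk : k = f *m (pinvmx f *m k).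
  apply/eqP; rewrite eq_sym -subr_eq0 mulmxA -{2}[k]mul1mx -mulmxBl.
  have /submxP[B ->] : (f *m pinvmx f - 1%:M <= X)%MS.
    by rewrite sub_kermx mulmxBl -mulmxA ff mulmx1 mul1mx subrr.
  by rewrite -mulmxA Xk0 mulmx0.
exists (pinvmx f *m k) => // x Gx; move: (pinvmx f *m k) Dk => h Dk.
have fI (A B : 'M_(m, n)) : f *m A = f *m B -> A = B.
  by move=> eqAB; rewrite -[A]mul1mx -[B]mul1mx -ff -!mulmxA eqAB.
by apply: fI; rewrite [LHS]mulmxA -homf // -[LHS]mulmxA -Dk homk // {1}Dk -[LHS]mulmxA.
Qed.

Section SdprodModules.

Variables (F : closedFieldType) (aT rT : finGroupType) (P : {group aT}).
Variables (K : {group rT}) (to : groupAction P K).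

Local Notation L := (sdprod_group to).

Section Restrictions.

Variables (n : nat) (rV : mx_representation F L n).

Lemma sdprod_kernel_mx_repr : mx_repr K (fun x => rV (sdpair1 to x)).
Proof.
split=> [|x y Kx Ky]; first by rewrite morph1 repr_mx1.
by rewrite morphM // repr_mxM ?inE.
Qed.

Definition sdprod_kernel_res := MxRepresentation sdprod_kernel_mx_repr.

Lemma sdprod_repr_pair u :
  rV u = sdprod_res rV (val u).1 *m sdprod_kernel_res (val u).2.
Proof. by rewrite {1}[u]sdpairE repr_mxM ?inE. Qed.

Lemma sdprod_res_compatible : compatible to sdprod_kernel_res (sdprod_res rV).
Proof.
move=> x a Kx Pa; rewrite /= -!repr_mxM ?inE //; congr (rV _).
by rewrite sdpair_act // conjgC.
Qed.

Lemma sdprod_mxmodule k (U : 'M_(k, n)) :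
  mxmodule sdprod_kernel_res U -> mxmodule (sdprod_res rV) U -> mxmodule rV U.
Proof.
move=> /mxmoduleP modK /mxmoduleP modP; apply/mxmoduleP=> u _.
rewrite sdprod_repr_pair; case: u => -[a x] /= /setXP[Pa Kx].
by rewrite mulmxA (submx_trans (submxMr _ (modP a Pa))) ?modK.
Qed.

Lemma sdprod_irr_pair :
  mx_irreducible rV -> pair_irreducible sdprod_kernel_res (sdprod_res rV).
Proof.
case/mx_irrP=> n_gt0 irrV; split=> // U modK modP; apply: irrV.
exact: sdprod_mxmodule.
Qed.

Lemma sdprod_kernel_semisimple :
  mx_irreducible rV -> mxsemisimple sdprod_kernel_res 1%:M.
Proof.
move=> irrV; have [_ nz1 _] := irrV.
have [Z simZ _] := dec_mxsimple_exists (mxmodule1 sdprod_kernel_res) nz1.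
have [modZ nzZ _] := simZ.
apply: (@pair_semisimple _ _ _ _ _ to _ _ P (submod_repr modZ) _ (sdprod_res rV)
  (subxx P) _ _ (val_submod 1%:M)).
- exact/submod_mx_irr.
- exact: sdprod_res_compatible.
- exact: sdprod_irr_pair.
- by move=> x Kx; rewrite -val_submodE -[submod_repr _ _]mul1mx (val_submodJ modZ).
- by rewrite val_submod_eq0 -mxrank_eq0 mxrank1 mxrank_eq0.
Qed.

End Restrictions.

Lemma sdprod_res_intertwines m n (rV : mx_representation F L m)
    (rW : mx_representation F L n) f :
    mx_intertwines (sdprod_kernel_res rV) (sdprod_kernel_res rW) f ->
    mx_intertwines (sdprod_res rV) (sdprod_res rW) f ->
  mx_intertwines rV rW f.
Proof.
move=> homK homP u _; rewrite !sdprod_repr_pair.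
case: u => -[a x] /= /setXP[Pa Kx].
by rewrite -mulmxA homK // mulmxA homP // mulmxA.
Qed.

Lemma sdprod_kernel_intertwines m n (rV : mx_representation F L m)
    (rW : mx_representation F L n) f :
  mx_intertwines rV rW f ->
  mx_intertwines (sdprod_kernel_res rV) (sdprod_kernel_res rW) f.
Proof. by move=> homf x Kx; rewrite homf ?inE. Qed.

(** Half of Frobenius reciprocity: the translates of E span E', so a homomorphism vanishing on E is
    zero. *)
Lemma induced_intertwines_neq0 d e n (rE : mx_representation F K d)
    (rE' : mx_representation F L e) (rV : mx_representation F L n) g :
    induced_along (sdpair1 to) rE rE' -> mx_intertwines rE' rV g -> g != 0 ->
  exists2 k, mx_intertwines rE (sdprod_kernel_res rV) k & k != 0.
Proof.
case=> f /= [_ homf _ fullT] homg nzg; exists (f *m g) => [x Kx|].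
  by rewrite mulmxA homf // -[LHS]mulmxA homg ?inE // [LHS]mulmxA.
apply: contraNneq nzg => fg0; rewrite -submx0 -[g]mul1mx.
apply: submx_trans (submxMr g fullT) _.
rewrite sumsmxMr_gen; apply/sumsmx_subP=> C _.
by rewrite genmxE (eqmxMr _ (genmxE _)) -mulmxA homg ?inE // mulmxA fg0 mul0mx sub0mx.
Qed.

Lemma cover_sdprod_constituent d m n (rE : mx_representation F K d)
    (rU : mx_representation F K m) (rV : mx_representation F L n) k :
    projective_cover rE rU -> mx_irreducible rV ->
    mx_intertwines rE (sdprod_kernel_res rV) k -> k != 0 ->
  exists2 h, mx_intertwines rU (sdprod_kernel_res rV) h & h != 0.
Proof.
case=> _ [f [homf fullf essf]] irrV homk nzk.
have [h homh Dk] := cover_factor homf fullf essf (sdprod_kernel_semisimple irrV) homk.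
by exists h => //; apply: contraNneq nzk => h0; rewrite Dk h0 mulmx0.
Qed.

End SdprodModules.

(** * The induced module and Frobenius reciprocity *)

Section InducedModule.

Variables (F : closedFieldType) (aT rT : finGroupType) (P : {group aT}).
Variables (K : {group rT}) (to : groupAction P K) (d : nat).
Variable rE : mx_representation F K d.

Local Notation L := (sdprod_group to).
Local Notation N := (#|P| * d)%N.
Local Notation idx := (gring_index P).

(* The row of index a of W is the coefficient of the translate by a of the    *)
(* base module; sdpair2 a * sdpair1 x sends it to the row of index b = c * a, *)
(* acting on the base module by x conjugated by b^-1.                         *)
Definition induced_act (u : sdprod_by to) (W : 'M[F]_(#|P|, d)) : 'M[F]_(#|P|, d) :=
  \matrix_i (row (idx (enum_val i * ((val u).1)^-1)%g) W
               *m rE (to (val u).2 (enum_val i)^-1%g)).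

Fact induced_act_is_linear u : linear (induced_act u).
Proof.
move=> c A B; apply/row_matrixP=> i; rewrite linearP /= !rowK.
by rewrite linearP mulmxDl scalemxAl.
Qed.

HB.instance Definition _ u :=
  GRing.isLinear.Build F _ _ _ (induced_act u) (induced_act_is_linear u).

Definition induced_mx u : 'M[F]_N := lin_mx (induced_act u).

Lemma mxvec_mul_inj k (A B : 'M[F]_(N, k)) :
  (forall W : 'M_(#|P|, d), mxvec W *m A = mxvec W *m B) -> A = B.
Proof.
move=> eqAB; apply/row_matrixP=> i; rewrite !rowE.
by rewrite -[delta_mx 0 i]vec_mxK eqAB.
Qed.

Lemma induced_mx_repr : mx_repr L induced_mx.
Proof.
split=> [|u v _ _]; apply: mxvec_mul_inj => W; rewrite ?mulmxA !mul_vec_lin /=.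
  rewrite mulmx1; congr mxvec; apply/row_matrixP=> i; rewrite rowK /=.
  have Pi := enum_valP i.
  by rewrite gact1 ?groupV // repr_mx1 mulmx1 invg1 mulg1 gring_valK.
congr mxvec; apply/row_matrixP=> i; rewrite !rowK.
case: u v => -[a x] /= /setXP[Pa Kx] [[b y] /= /setXP[Pb Ky]].
have Pi := enum_valP i.
have Pib : (enum_val i * b^-1)%g \in P by rewrite groupM ?groupV.
rewrite gring_indexK // -mulmxA -repr_mxM ?gact_stable ?groupV //.
rewrite gactM ?gact_stable ?groupV // -actMin ?groupV //.
by rewrite !invMg invgK mulgA.
Qed.

Definition induced_repr := MxRepresentation induced_mx_repr.

Definition induced_emb : 'M[F]_(d, N) :=
  lin1_mx (mxvec \o mulmx (delta_mx (idx 1%g) 0)).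

Lemma induced_embE v : v *m induced_emb = mxvec (delta_mx (idx 1%g) 0 *m v).
Proof. by rewrite mul_rV_lin1. Qed.

Lemma induced_emb_translate (v : 'rV_d) a : a \in P ->
  v *m induced_emb *m induced_repr (sdpair2 to a) = mxvec (delta_mx (idx a) 0 *m v).
Proof.
move=> Pa; rewrite induced_embE mul_vec_lin /=; congr mxvec.
apply/row_matrixP=> i; rewrite rowK val_insubd !inE Pa group1 /=.
have Pi := enum_valP i.
rewrite gact1 ?groupV // repr_mx1 mulmx1 !row_mul; congr (_ *m _).
apply/rowP=> j; rewrite !mxE !ord1 eqxx !andbT; congr (_%:R).
rewrite -(inj_eq enum_val_inj) -[in RHS](inj_eq enum_val_inj) !gring_indexK ?groupM ?groupV //.
by rewrite -(inj_eq (mulIg a)) mulgKV mul1g.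
Qed.


Lemma induced_emb_intertwines :
  {in K, forall x, rE x *m induced_emb = induced_emb *m induced_repr (sdpair1 to x)}.
Proof.
move=> x Kx; apply/row_matrixP=> j; rewrite !rowE !mulmxA.
move: (delta_mx 0 j) => v; rewrite !induced_embE mul_vec_lin /=; congr mxvec.
apply/row_matrixP=> i; rewrite rowK val_insubd !inE Kx group1 /=.
rewrite invg1 mulg1 gring_valK !row_mul !mulmxA.
have [-> | ni1] := eqVneq i (idx 1%g).
  by rewrite gring_indexK // invg1 act1.
rewrite (_ : row i _ = 0) ?mul0mx //; apply/rowP=> k.
by rewrite !mxE (negPf ni1).
Qed.

Lemma induced_emb_free : row_free induced_emb.
Proof.
apply/row_freeP; exists (lin1_mx (row (idx 1%g) \o vec_mx)).
apply/row_matrixP=> j; rewrite !rowE mulmx1 mulmxA induced_embE mul_rV_lin1 /=.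
rewrite mxvecK row_mul (_ : row _ _ = 1%:M) ?mul1mx //.
by apply/rowP=> k; rewrite !mxE !ord1 !eqxx.
Qed.

Lemma induced_mxvecE W :
  mxvec W = \sum_i row i W *m induced_emb *m induced_repr (sdpair2 to (enum_val i)).
Proof.
rewrite (eq_bigr (fun i => mxvec (delta_mx i 0 *m row i W))) => [|i _]; last first.
  by rewrite induced_emb_translate ?enum_valP // gring_valK.
rewrite -linear_sum /=; congr mxvec; apply/matrixP=> i j.
rewrite summxE (bigD1 i) //= big1 ?addr0 => [|k nki].
  by rewrite mxE big_ord1 !mxE !eqxx mul1r.
by rewrite mxE big_ord1 !mxE eq_sym (negPf nki) mul0r.
Qed.

Section Extension.

Variables (n : nat) (rA : mx_representation F L n).

Lemma induced_hom_inj (h k : 'M_(N, n)) :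
    mx_intertwines induced_repr rA h -> mx_intertwines induced_repr rA k ->
  induced_emb *m h = induced_emb *m k -> h = k.
Proof.
move=> homh homk eq_hk; apply: mxvec_mul_inj => W.
rewrite induced_mxvecE !mulmx_suml; apply: eq_bigr => i _.
by rewrite -!(mulmxA _ (induced_repr _)) homh ?homk ?inE // !mulmxA -!(mulmxA _ induced_emb) eq_hk.
Qed.

Variable g0 : 'M[F]_(d, n).
Hypothesis homg0 : mx_intertwines rE (sdprod_kernel_res rA) g0.

(** The extension of [g0] from the base module given by Frobenius reciprocity: the row of index [a]
    is mapped by [g0], then translated by [a]. *)
Definition induced_ext : 'M[F]_(N, n) :=
  \sum_i lin1_mx (mulmxr (g0 *m rA (sdpair2 to (enum_val i))) \o row i \o vec_mx).

Lemma induced_extE W : mxvec W *m induced_ext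
  = \sum_i row i W *m (g0 *m rA (sdpair2 to (enum_val i))).
Proof.
by rewrite mulmx_sumr; apply: eq_bigr => i _; rewrite mul_rV_lin1 /= mxvecK.
Qed.

Lemma induced_ext_emb : induced_emb *m induced_ext = g0.
Proof.
apply/row_matrixP=> j; rewrite !rowE mulmxA; move: (delta_mx 0 j) => v.
rewrite induced_embE induced_extE (bigD1 (idx 1%g)) //= big1 ?addr0 => [|i ni1].
  rewrite gring_indexK // morph1 repr_mx1 mulmx1 row_mul (_ : row _ _ = 1%:M) ?mul1mx //.
  by apply/rowP=> k; rewrite !mxE !ord1 !eqxx.
rewrite row_mul (_ : row i _ = 0) ?mul0mx //; apply/rowP=> k.
by rewrite !mxE (negPf ni1).
Qed.

Lemma induced_ext_intertwines : mx_intertwines induced_repr rA induced_ext.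
Proof.
move=> u _; apply: mxvec_mul_inj => W; rewrite !mulmxA mul_vec_lin !induced_extE.
have [Pu Ku] : (val u).1 \in P /\ (val u).2 \in K by case: u => -[a x] /= /setXP.
rewrite mulmx_suml.
pose s (i : 'I_#|P|) := idx (enum_val i * (val u).1)%g.
pose s' (i : 'I_#|P|) := idx (enum_val i * ((val u).1)^-1)%g.
have Ks : cancel s s'.
  by move=> i; rewrite /s /s' gring_indexK ?groupM ?enum_valP // mulgK gring_valK.
have s_inj := can_inj Ks.
rewrite (reindex_inj s_inj) /=; apply: eq_bigr => i _.
rewrite rowK -/(s' (s i)) Ks gring_indexK ?groupM ?enum_valP // -!mulmxA; congr (_ *m _).
set b := (enum_val i * _)%g; have Pb : b \in P by rewrite groupM ?enum_valP.
have Kub : to (val u).2 b^-1%g \in K by rewrite gact_stable ?groupV.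
rewrite mulmxA homg0 // -!mulmxA; congr (_ *m _).
rewrite [sdprod_kernel_res rA _]/= -!repr_mxM ?inE //.
congr (rA _); rewrite sdpair_act ?groupV // morphV // conjgE invgK mulgA mulgKV.
by rewrite /b morphM ?enum_valP // [in RHS](sdpairE u) mulgA.
Qed.

End Extension.

(** A lifting problem is restricted to the base module, solved over K and extended back; two
    homomorphisms agreeing on the base module are equal. *)
Lemma induced_repr_projective : mx_projective rE -> mx_projective induced_repr.
Proof.
move=> projE a b rA rB f h homf fullf homh.
have [|k0 homk0 Dk0] := projE _ _ (sdprod_kernel_res rA) (sdprod_kernel_res rB) f
  (induced_emb *m h) (sdprod_kernel_intertwines homf) fullf _.
  by move=> x Kx; rewrite mulmxA induced_emb_intertwines // -!mulmxA homh ?inE.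
exists (induced_ext rA k0); first exact: induced_ext_intertwines.
apply: induced_hom_inj homh _.
  exact: intertwines_comp (induced_ext_intertwines homk0) homf.
by rewrite mulmxA induced_ext_emb.
Qed.

Lemma induced_repr_along : induced_along (sdpair1 to) rE induced_repr.
Proof.
exists induced_emb; set T := (\sum_(C in _) _)%MS => /=.
have fullT : (1%:M <= T)%MS.
  apply/row_subP=> j; rewrite rowE mulmx1 -[delta_mx 0 j]vec_mxK induced_mxvecE.
  apply: summx_sub => i _; rewrite -mulmxA mulmx_sub //.
  set a := sdpair2 to _; pose C := (sdpair1 to @* K :* a)%g.
  have CC : C \in rcosets (sdpair1 to @* K) L by apply/rcosetsP; exists a; rewrite ?inE.
  have [_ /morphimP[x _ Kx ->] Dr] : exists2 y, y \in (sdpair1 to @* K)%g & repr C = (y * a)%g.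
    by apply/rcosetP; apply: mem_repr_rcoset.
  have DrC : induced_emb *m induced_repr (repr C) = rE x *m (induced_emb *m induced_repr a).
    have -> : repr C = (sdpair1 to x * a)%g by [].
    rewrite (repr_mxM induced_repr (in_setT _) (in_setT _)) [LHS]mulmxA.
    by rewrite -(induced_emb_intertwines Kx) -[LHS]mulmxA.
  apply: submx_trans (_ : _ <= <<induced_emb *m induced_repr (repr C)>>)%MS _; last first.
    exact: (sumsmx_sup C CC (submx_refl _)).
  rewrite genmxE DrC; apply/submxP; exists (rE x^-1%g).
  by rewrite [RHS]mulmxA -repr_mxM ?groupV // mulVg repr_mx1 mul1mx.
have rank_im C : \rank <<induced_emb *m induced_repr (repr C)>> = d.
  by rewrite mxrank_gen mxrankMfree ?repr_mx_free ?inE //; apply/eqP/induced_emb_free.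
split=> //.
- exact: induced_emb_free.
- exact: induced_emb_intertwines.
(* Directness by dimensions: there are as many cosets as elements of P, each contributing [d]. *)
rewrite mxdirectE /= (eq_bigr (fun=> d)) => [|C _]; last exact: rank_im.
rewrite sum_nat_const -[#|_|]/(#|L : sdpair1 to @* K|) -divgS ?subsetT //.
rewrite -(sdprod_card (sdprod_sdpair to)) mulKn ?cardG_gt0 // card_injm ?injm_sdpair2 //.
by move: fullT; rewrite sub1mx.
Qed.

End InducedModule.

(** * Free summands for a generalized piece *)

Lemma irr_quotient_mod (F : fieldType) (gT : finGroupType) (G : {group gT}) n
    (rM : mx_representation F G n) (U : 'M_n) :
    mxmodule rM U -> ~~ (1%:M <= U)%MS ->
  exists k (rV : mx_representation F G k) g,
    [/\ mx_irreducible rV, mx_intertwines rM rV g, g != 0 & U *m g = 0].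
Proof.
move=> modU nfullU.
have coU : (0 < \rank (cokermx U))%N.
  rewrite mxrank_coker subn_gt0 ltn_neqAle rank_leq_row andbT.
  by rewrite sub1mx in nfullU.
have [k [rV [g [irrV homg nzg]]]] := irr_quotient_exists (factmod_repr modU) coU.
exists k, rV, (in_factmod U 1%:M *m g); split=> //.
- exact: intertwines_comp (in_factmod_intertwines modU) homg.
- by rewrite in_factmod_mul_eq0.
have /eqP U0 : in_factmod U U == 0 by rewrite in_factmod_eq0.
by rewrite mulmxA -in_factmodE U0 mul0mx.
Qed.

(* Two distinct maximal submodules of the induced module would have           *)
(* isomorphic quotients, and hence give two independent K-homomorphisms from  *)
(* U to this quotient.                                                        *)
Lemma induced_repr_cover (F : closedFieldType) (p : nat) (aT rT : finGroupType)
    (P : {group aT}) (K : {group rT}) (to : groupAction P K) d m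
    (rE : mx_representation F K d) (rU : mx_representation F K m) :
    p \in [pchar F] -> p.-group P -> mx_irreducible rU -> projective_cover rE rU ->
  exists n (rV : mx_representation F (sdprod_group to) n),
    mx_irreducible rV /\ projective_cover (induced_repr to rE) rV.
Proof.
move=> charFp pP irrU [projE [f [homf fullf essf]]].
have [m_gt0 _] := iffLR (mx_irrP rU) irrU.
have d_gt0 : (0 < d)%N by rewrite (leq_trans m_gt0) // -(eqP fullf) rank_leq_row.
have N_gt0 : (0 < #|P| * d)%N by rewrite muln_gt0 cardG_gt0.
have [n [rV [g [irrV homg nzg]]]] := irr_quotient_exists (induced_repr to rE) N_gt0.
exists n, rV; split=> //; split; first exact: induced_repr_projective.
exists g; split=> //; first exact: irr_intertwines_full homg irrV nzg.
move=> M modM sub1; apply: contraT => nfullM.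
have [n2 [rV2 [g2 [irrV2 homg2 nzg2 Mg2]]]] := irr_quotient_mod modM nfullM.
pose emb := induced_emb F P d.
have emb_hom k (rA : mx_representation F (sdprod_group to) k) h :
    mx_intertwines (induced_repr to rE) rA h ->
  mx_intertwines rE (sdprod_kernel_res rA) (emb *m h).
  move=> homh x Kx; rewrite mulmxA (induced_emb_intertwines to rE Kx).
  by rewrite -[LHS]mulmxA homh ?inE // mulmxA.
have constituent k (rA : mx_representation F (sdprod_group to) k) h :
    mx_irreducible rA -> mx_intertwines (induced_repr to rE) rA h ->
  exists2 u, mx_intertwines rU (sdprod_kernel_res rA) u & emb *m h = f *m u.
  move=> irrA homh.
  exact: cover_factor homf fullf essf (sdprod_kernel_semisimple irrA) (emb_hom _ _ _ homh).
have emb_inj k (rA : mx_representation F (sdprod_group to) k) h :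
    mx_intertwines (induced_repr to rE) rA h -> emb *m h = 0 -> h = 0.
  move=> homh h0; apply: (induced_hom_inj homh); last by rewrite h0 mulmx0.
  by move=> x _; rewrite mulmx0 mul0mx.
have [u homu Du] := constituent _ _ _ irrV homg.
have [u2 homu2 Du2] := constituent _ _ _ irrV2 homg2.
have nzu : u != 0.
  by apply: contraNneq nzg => u0; apply/eqP/(emb_inj _ _ _ homg); rewrite Du u0 mulmx0.
have nzu2 : u2 != 0.
  by apply: contraNneq nzg2 => u0; apply/eqP/(emb_inj _ _ _ homg2); rewrite Du2 u0 mulmx0.
have [q [nzq homKq homPq]] := pair_common_constituent (subxx P) irrU
  (sdprod_res_compatible rV2) (sdprod_res_compatible rV) charFp pP (sdprod_irr_pair irrV2)
  homu2 nzu2 homu nzu.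
have homq := sdprod_res_intertwines homKq homPq.
have freeq := irr_intertwines_free homq irrV2 nzq.
pose g3 := g2 *m q.
have homg3 : mx_intertwines (induced_repr to rE) rV g3 by apply: intertwines_comp homg2 homq.
have nzg3 : g3 != 0 by rewrite mulmx_free_eq0.
have [u3 homu3 Du3] := constituent _ _ _ irrV homg3.
(* Multiplicity one makes [g3] a scalar multiple of [g], so [M] also lies in the kernel of [g];
   together with [sub1] this would force [g = 0]. *)
have [c Dc] := pair_multiplicity_one charFp pP irrU (sdprod_res_compatible rV)
  (sdprod_irr_pair irrV) homu nzu homu3.
have Dg3 : g3 = c *: g.
  apply: (induced_hom_inj homg3); first exact: intertwinesZ.
  by rewrite -/emb -scalemxAr Du Du3 Dc scalemxAr.
have nzc : c != 0 by apply: contraNneq nzg3 => c0; rewrite Dg3 c0 scale0r.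
have Mg : M *m g = 0.
  apply: (scalerI nzc); rewrite scalemxAr -Dg3 /g3 mulmxA Mg2 mul0mx scaler0 //.
case/eqP: nzg; rewrite -[g]mul1mx; apply/sub_kermxP; apply: submx_trans sub1 _.
by rewrite addsmx_sub submx_refl andbT; apply/sub_kermxP.
Qed.

(** The induced cover maps onto V, so E(eta) maps nontrivially to V; as V is semisimple over K, this
    map factors through V(eta). *)
Lemma sdprod_brauer_constituent (F : closedFieldType) (p : nat) (theta : F -> algC)
    (aT rT : finGroupType) (P : {group aT}) (K : {group rT}) (to : groupAction P K)
    eta (xi : {ffun sdprod_by to -> algC}) n (rV : mx_representation F (sdprod_group to) n) m
    (rU : mx_representation F K m) :
    p \in [pchar F] -> brauer_lift theta -> sdprod_brauer p theta eta xi ->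
    simple_affording p theta xi rV -> simple_affording p theta eta rU ->
  exists2 e, mx_intertwines rU (sdprod_kernel_res rV) e & e != 0.
Proof.
move=> charFp theta_lift [d [d' [rE [rE' []]]]].
case=> m0 [rU0 [affU0 covE]] [n0 [rV0 [affV0 [_ [f [homf fullf _]]]]]] ind affV affU.
have [g [homg freeg fullg]] := rsim_intertwines
  (simple_affording_rsim charFp theta_lift affV0 affV).
have [b [homb freeb fullb]] := rsim_intertwines
  (simple_affording_rsim charFp theta_lift affU affU0).
have [irrV _] := affV; have [irrU _] := affU; have [n_gt0 _] := iffLR (mx_irrP rV) irrV.
have homfg := intertwines_comp homf homg.
have nzfg : f *m g != 0.
  rewrite -mxrank_eq0 mxrankMfree // (eqP fullf).
  by rewrite -lt0n; case/mx_irrP: affV0.1.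
have [k homk nzk] := induced_intertwines_neq0 ind homfg nzfg.
have [h homh nzh] := cover_sdprod_constituent covE irrV homk nzk.
exists (b *m h); first exact: intertwines_comp homb homh.
apply: contraNneq nzh => bh0; rewrite -[h]mul1mx.
by have /row_fullP[b' <-] := fullb; rewrite -mulmxA bh0 mulmx0.
Qed.

Section GeneralizedPieceActions.

Variables (F : closedFieldType) (p : nat) (theta : F -> algC).
Variables (gT : finGroupType) (G : {group gT}) (X : generalized_piece p theta G).

Local Notation Q := (gp_Q X).
Local Notation P := (gp_P X).
Local Notation K := 'C_G(Q)%G.

Lemma gp_actE (S : {group coset_of Q}) (sSN : S \subset gp_Nbar X) x g :
  x \in 'C_G(Q) -> g \in 'N_P(Q) -> coset Q g \in S -> gp_act sSN x (coset Q g) = (x ^ g)%g.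
Proof.
move=> Kx /setIP[Pg Ng] Sg; rewrite /gp_act /conj_gact /= /actby Kx Sg /=.
have [Gx Cx] := setIP Kx.
apply: modactE => //.
by apply/afixP=> z /setIP[_ Qz]; rewrite /= conjgE (centP Cx z Qz) mulKg.
Qed.

Lemma gp_act_sub (S : {group coset_of Q}) (sSN : S \subset gp_Nbar X) x a :
  x \in 'C_G(Q) -> a \in S -> gp_act sSN x a = gp_act (subxx (gp_Nbar X)) x a.
Proof.
move=> Kx Sa; have /morphimP[g Ng PNg Da] := subsetP sSN a Sa.
by rewrite Da in Sa *; rewrite !gp_actE // mem_quotient.
Qed.

(** The invertible intertwiner makes [rU y] similar to [rU] at the conjugate of [y], so the Brauer
    character is invariant under conjugation. *)
Lemma stabilizes_gp_stab m (rU : mx_representation F K m) a :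
    simple_affording p theta (gp_phi X) rU -> a \in gp_Nbar X ->
    stabilizes (gp_act (subxx (gp_Nbar X))) rU a ->
  a \in (gp_stab X / Q)%g.
Proof.
case=> irrU Dphi Na [A nzA homA].
have uA := stabilizes_unit irrU Na nzA homA.
have /morphimP[g Ng PNg Da] := Na.
have [Pg _] := setIP PNg; have Gg := subsetP (gp_P_sub X) g Pg.
have nKg : g \in 'N('C_G(Q)).
  by apply/normP; rewrite conjIg conjGid // -centJ (normP Ng).
rewrite Da mem_morphim // inE Pg /=; apply/eqP; congr (_, _).
  by apply/normP; rewrite groupV.
apply/ffunP=> y; rewrite ffunE /= -Dphi !ffunE p_eltJ memJ_norm //.
case: ifP => // /andP[Ky _]; congr (\sum_(z <- _) _).
by rewrite (eigenvalues_similar uA (homA y Ky)) Da gp_actE // -Da.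
Qed.

Lemma gp_norm_mx_iff (S : {group coset_of Q}) (sSN : S \subset gp_Nbar X)
    (xi : {ffun sdprod_by (gp_act sSN) -> algC}) n
    (V : mx_representation F (sdprod_group (gp_act sSN)) n)
    (xi' : {ffun sdprod_by (gp_act (subxx (gp_Nbar X))) -> algC}) n'
    (V' : mx_representation F (sdprod_group (gp_act (subxx (gp_Nbar X)))) n') :
    p \in [pchar F] -> brauer_lift theta -> (gp_stab X / Q)%g \subset S ->
    sdprod_brauer p theta (gp_phi X) xi -> simple_affording p theta xi V ->
    sdprod_brauer p theta (gp_phi X) xi' -> simple_affording p theta xi' V' ->
  has_free_summand (sdprod_res V) <-> has_free_summand (sdprod_res V').
Proof.
move=> charFp theta_lift stabS xiP V_xi xi'P V'_xi.
have pN : p.-group (gp_Nbar X).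
  by rewrite quotient_pgroup // (pgroupS (subsetIl _ _)) // gp_P_pgroup.
have pS := pgroupS sSN pN.
have [m [rU affU]] := gp_phi_irr X; have [irrU _] := affU.
have [e home nze] := sdprod_brauer_constituent charFp theta_lift xiP V_xi affU.
have [e' home' nze'] := sdprod_brauer_constituent charFp theta_lift xi'P V'_xi affU.
have [irrV _] := V_xi; have [irrV' _] := V'_xi.
(* V is viewed as a pair over the action of the whole of [gp_Nbar X], so that V and V' fall under
   the same Clifford theory. *)
have cKS : compatible (gp_act (subxx (gp_Nbar X))) (sdprod_kernel_res V) (sdprod_res V).
  by move=> x a Kx Sa; rewrite -(gp_act_sub sSN Kx Sa); apply: sdprod_res_compatible.
have eq_norm := norm_mx_pair_iff charFp pN sSN irrU
  (fun a Na sta => subsetP stabS a (stabilizes_gp_stab affU Na sta))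
  cKS (sdprod_res_compatible V') (sdprod_irr_pair irrV) (sdprod_irr_pair irrV')
  home nze home' nze'.
split=> /free_summand_norm nz; apply: (norm_free_summand charFp) => //.
  by rewrite -eq_norm.
by rewrite eq_norm.
Qed.

End GeneralizedPieceActions.

Theorem proposition2p3 (F : closedFieldType) (p : nat)
    (char_F : p \in [pchar F])
    (theta : F -> algC) (theta_lift : brauer_lift theta)
    (gT : finGroupType) (G : {group gT})
    (X : generalized_piece p theta G)
    (S : {group coset_of (gp_Q X)})
    (stab_sub_S : (gp_stab X / gp_Q X)%g \subset S)
    (S_sub_Nbar : S \subset gp_Nbar X)
    (xi : {ffun sdprod_by (gp_act S_sub_Nbar) -> algC})
    (xi_def : sdprod_brauer p theta (gp_phi X) xi)
    (n : nat) (V : mx_representation F (sdprod_group (gp_act S_sub_Nbar)) n)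
    (V_xi : simple_affording p theta xi V) :
  substantive X <-> has_free_summand (sdprod_res V).
Proof.
split=> [[xi' [n' [V' [xi'_def V'_xi freeV']]]] | freeV].
  exact/(gp_norm_mx_iff char_F theta_lift stab_sub_S xi_def V_xi xi'_def V'_xi).
have pN : p.-group (gp_Nbar X).
  by rewrite quotient_pgroup // (pgroupS (subsetIl _ _)) // gp_P_pgroup.
(* [substantive] asks for a witness: the E(phi) contained in [xi_def] is induced to the larger
   semidirect product, and the Brauer character of the simple module it covers serves as [xi']. *)
have [d [_ [rE [_ [[m [rU [affU covE]]] _ _]]]]] := xi_def.
have [irrU _] := affU.
have [n' [V' [irrV' covV']]] :=
  induced_repr_cover (gp_act (subxx (gp_Nbar X))) char_F pN irrU covE.
pose xi' := brauer_char p theta V'.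
have V'_xi : simple_affording p theta xi' V' by [].
have xi'_def : sdprod_brauer p theta (gp_phi X) xi'.
  exists d, _, rE, (induced_repr _ rE); split; last exact: induced_repr_along.
    by exists m, rU.
  by exists n', V'.
exists xi', n', V'; split=> //.
exact/(gp_norm_mx_iff char_F theta_lift stab_sub_S xi_def V_xi xi'_def V'_xi).
Qed.
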